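(* Let $A$ be a Noetherian ring and let $\varphi_A: P_A=A[[x_1,\dots,x_n]]\to \widetilde R_A=A[[t_1]]\oplus\dots\oplus A[[t_r]]$ be a family of parameterizations over $A$. Fix $\mathfrak p\in\operatorname{Spec}A$. Assume that $\varphi_{\mathfrak p}:P_{\mathfrak p}\to\widetilde R_{\mathfrak p}$ is a parameterization of the reduced curve singularity $R_{\mathfrak p}\cong\varphi_{\mathfrak p}(P_{\mathfrak p})$ with $r$ branches, i.e. for each $j\in\{1,\dots,r\}$ there is at least one $i$ with $\varphi_{\mathfrak p,j}(x_i)\neq 0$, and $\operatorname{Ker}(\varphi_{\mathfrak p,j})\neq\operatorname{Ker}(\varphi_{\mathfrak p,j'})$ for $j\neq j'$. Assume moreover that $\dim_{k(\mathfrak p)}(\widetilde R_{\mathfrak p}/R_{\mathfrak p})<\infty$. Then there exists an open neighbourhood $U\subset\operatorname{Spec}A$ of $\mathfrak p$ such that: (1) $R_{\mathfrak q}\hookrightarrow\widetilde R_{\mathfrak q}$ is the normalization of $R_{\mathfrak q}$ for each $\mathfrak q\in U$; (2) the function $\mathfrak q\mapsto\delta_{k(\mathfrak q)}(R_{\mathfrak q})$ is upper semicontinuous on $U$.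
   Context: All rings are commutative with 1. Families of parameterizations. Let $A$ be a Noetherian ring. A family of parameterizations over $A$ is a morphism of $A$-algebras $\varphi_A:P_A:=A[[x_1,\dots,x_n]]\to\widetilde R_A:=A[[t_1]]\oplus\dots\oplus A[[t_r]]$ such that, writing $\varphi_{A,j}:P_A\to A[[t_j]]$ for the composition of $\varphi_A$ with the projection to the $j$-th factor, one has $\varphi_{A,j}(x_i)\in t_jA[[t_j]]$ for all $i,j$ and $\operatorname{Ker}(\varphi_{A,j})\neq\operatorname{Ker}(\varphi_{A,j'})$ for $j\neq j'$. For $\mathfrak q\in\operatorname{Spec}A$ let $k(\mathfrak q)=A_{\mathfrak q}/\mathfrak qA_{\mathfrak q}$, $P_{\mathfrak q}:=k(\mathfrak q)[[x_1,\dots,x_n]]$, $\widetilde R_{\mathfrak q}:=k(\mathfrak q)[[t_1]]\oplus\dots\oplus k(\mathfrak q)[[t_r]]$. Let $\varphi_{\mathfrak q}:P_{\mathfrak q}\to\widetilde R_{\mathfrak q}$ be the induced $k(\mathfrak q)$-algebra morphism, i.e. $\varphi_{\mathfrak q}(x_i)$ is obtained from $\varphi_A(x_i)$ by mapping all coefficients to $k(\mathfrak q)$, and let $\varphi_{\mathfrak q,j}:P_{\mathfrak q}\to k(\mathfrak q)[[t_j]]$ be its $j$-th component. Put $R_{\mathfrak q}:=P_{\mathfrak q}/\operatorname{Ker}(\varphi_{\mathfrak q})\cong\varphi_{\mathfrak q}(P_{\mathfrak q})\subset\widetilde R_{\mathfrak q}$. Normalization and delta. For a reduced Noetherian ring $R$,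 $\overline R$ denotes the integral closure of $R$ in its total quotient ring; the inclusion $R\hookrightarrow\overline R$ is the normalization of $R$. For a field $k$ and a ring map $k\to R$ with $R$ a reduced local ring, $\delta_k(R):=\dim_k\overline R/R$. Upper semicontinuity of $\mathfrak q\mapsto\delta_{k(\mathfrak q)}(R_{\mathfrak q})$ on $U$ means: every $\mathfrak p'\in U$ has an open neighbourhood $U'\subset U$ such that $\delta_{k(\mathfrak q)}(R_{\mathfrak q})\le\delta_{k(\mathfrak p')}(R_{\mathfrak p'})$ for all $\mathfrak q\in U'$. *)

(* Defs.v *)
(* MathComp with the classical axioms of mathcomp.classical.boolp. *)
From HB Require Import structures.
From mathcomp Require Import all_boot all_order all_algebra.
From mathcomp Require Import boolp classical_sets.
From mathcomp Require Import mpoly.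
From mathcomp Require Import ring.

Set Implicit Arguments.
Unset Strict Implicit.
Unset Printing Implicit Defensive.

Import GRing.Theory.
Local Open Scope ring_scope.
Local Open Scope quotient_scope.

(* [f : pseries A] is the series sum_m f m * t^m. *)
Definition pseries (A : Type) : Type := nat -> A.

HB.instance Definition _ (A : choiceType) := Choice.copy (pseries A) (nat -> A).

Section PSeriesZmod.
Variable A : zmodType.
Implicit Types f g h : pseries A.

Definition ps_zero : pseries A := fun=> 0.
Definition ps_opp f : pseries A := fun m => - f m.
Definition ps_add f g : pseries A := fun m => f m + g m.

Fact ps_addA : associative ps_add.
Proof. by move=> f g h; apply/funext=> m; apply: addrA. Qed.
Fact ps_addC : commutative ps_add.
Proof. by move=> f g; apply/funext=> m; apply: addrC. Qed.
Fact ps_add0 : left_id ps_zero ps_add.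
Proof. by move=> f; apply/funext=> m; apply: add0r. Qed.
Fact ps_addN : left_inverse ps_zero ps_opp ps_add.
Proof. by move=> f; apply/funext=> m; apply: addNr. Qed.

HB.instance Definition _ :=
  GRing.isZmodule.Build (pseries A) ps_addA ps_addC ps_add0 ps_addN.

Lemma ps_sumE I (r : seq I) P (F : I -> pseries A) m :
  (\sum_(i <- r | P i) F i) m = \sum_(i <- r | P i) F i m.
Proof. by elim/big_rec2: _ => // i x y _ <-. Qed.

End PSeriesZmod.

Section PSeriesRing.
Variable A : comNzRingType.
Implicit Types f g h : pseries A.

Definition ps_const (a : A) : pseries A := fun m => if m == 0%N then a else 0.
Definition ps_one : pseries A := ps_const 1.
Definition ps_mul f g : pseries A :=
  fun m => \sum_(i < m.+1) f i * g (m - i)%N.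

Let tr d f : {poly A} := \poly_(i < d) f i.

Let trE d f i : (i < d)%N -> (tr d f)`_i = f i.
Proof. by rewrite coef_poly => ->. Qed.

Let ps_mulE d f g m : (m < d)%N -> ps_mul f g m = (tr d f * tr d g)`_m.
Proof.
move=> md; rewrite coefM; apply: eq_bigr => i _.
by rewrite !trE // (leq_ltn_trans _ md) ?leq_subr // -ltnS.
Qed.

Fact ps_mulC : commutative ps_mul.
Proof.
by move=> f g; apply/funext=> m; rewrite !(ps_mulE _ _ (ltnSn m)) mulrC.
Qed.

Fact ps_mulA : associative ps_mul.
Proof.
move=> f g h; apply/funext=> m.
have -> : ps_mul f (ps_mul g h) m
        = (tr m.+1 f * (tr m.+1 g * tr m.+1 h))`_m.
  rewrite (ps_mulE _ _ (ltnSn m)) !coefM; apply: eq_bigr => i _.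
  have lt : (m - i < m.+1)%N by rewrite ltnS leq_subr.
  by rewrite -ps_mulE // (trE _ lt).
have -> : ps_mul (ps_mul f g) h m
        = ((tr m.+1 f * tr m.+1 g) * tr m.+1 h)`_m.
  rewrite (ps_mulE _ _ (ltnSn m)) !coefM; apply: eq_bigr => i _.
  by rewrite -ps_mulE // (trE _ (ltn_ord i)).
by rewrite mulrA.
Qed.

Fact ps_mul1 : left_id ps_one ps_mul.
Proof.
move=> f; apply/funext=> m; rewrite /ps_mul big_ord_recl /= mul1r subn0.
by rewrite big1 ?addr0 // => i _; rewrite /ps_one /ps_const /= mul0r.
Qed.

Fact ps_mulDl : left_distributive ps_mul +%R.
Proof.
move=> f g h; apply/funext=> m; transitivity (ps_mul f h m + ps_mul g h m) => //.
by rewrite /ps_mul -big_split; apply: eq_bigr => i _; apply: mulrDl.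
Qed.

Fact ps_one_neq0 : ps_one != 0.
Proof.
by apply/eqP => /(congr1 (fun f : pseries A => f 0%N)) /eqP; rewrite oner_eq0.
Qed.

HB.instance Definition _ := GRing.Zmodule_isComNzRing.Build (pseries A)
  ps_mulA ps_mulC ps_mul1 ps_mulDl ps_one_neq0.

Definition ps_scale (a : A) f : pseries A := fun m => a * f m.

Fact ps_scaleA a b f : ps_scale a (ps_scale b f) = ps_scale (a * b) f.
Proof. by apply/funext=> m; apply: mulrA. Qed.
Fact ps_scale1 : left_id 1 ps_scale.
Proof. by move=> f; apply/funext=> m; apply: mul1r. Qed.
Fact ps_scaleDr : right_distributive ps_scale +%R.
Proof. by move=> a f g; apply/funext=> m; apply: mulrDr. Qed.
Fact ps_scaleDl f : {morph ps_scale^~ f : a b / a + b}.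
Proof. by move=> a b; apply/funext=> m; apply: mulrDl. Qed.

HB.instance Definition _ := GRing.Zmodule_isLmodule.Build A (pseries A)
  ps_scaleA ps_scale1 ps_scaleDr ps_scaleDl.

Fact ps_scaleAl a f g : a *: (f * g) = a *: f * g.
Proof.
apply/funext=> m; rewrite [LHS]big_distrr.
by apply: eq_bigr => i _; apply: mulrA.
Qed.

HB.instance Definition _ :=
  GRing.LSemiModule_isLSemiAlgebra.Build A (pseries A) ps_scaleAl.
HB.instance Definition _ := GRing.Lalgebra_isComAlgebra.Build A (pseries A).

Lemma ps_coefM f g m : (f * g) m = \sum_(i < m.+1) f i * g (m - i)%N.
Proof. by []. Qed.

Lemma ps_coefZ a f m : (a *: f) m = a * f m.
Proof. by []. Qed.

Lemma ps_coef1 m : (1 : pseries A) m = (m == 0%N)%:R.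
Proof. by transitivity (ps_one m); rewrite // /ps_one /ps_const; case: eqP. Qed.

End PSeriesRing.

(* [f : mpseries n A] is the series sum_m f m * x^m over all monomials m. *)
Definition mpseries (n : nat) (A : Type) : Type := 'X_{1..n} -> A.

HB.instance Definition _ n (A : choiceType) :=
  Choice.copy (mpseries n A) ('X_{1..n} -> A).

Section MPSeriesZmod.
Variables (n : nat) (A : zmodType).
Implicit Types f g h : mpseries n A.

Definition mps_zero : mpseries n A := fun=> 0.
Definition mps_opp f : mpseries n A := fun m => - f m.
Definition mps_add f g : mpseries n A := fun m => f m + g m.

Fact mps_addA : associative mps_add.
Proof. by move=> f g h; apply/funext=> m; apply: addrA. Qed.
Fact mps_addC : commutative mps_add.
Proof. by move=> f g; apply/funext=> m; apply: addrC. Qed.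
Fact mps_add0 : left_id mps_zero mps_add.
Proof. by move=> f; apply/funext=> m; apply: add0r. Qed.
Fact mps_addN : left_inverse mps_zero mps_opp mps_add.
Proof. by move=> f; apply/funext=> m; apply: addNr. Qed.

HB.instance Definition _ :=
  GRing.isZmodule.Build (mpseries n A) mps_addA mps_addC mps_add0 mps_addN.

End MPSeriesZmod.

Section MPSeriesRing.
Variables (n : nat) (A : comNzRingType).
Implicit Types (f g h : mpseries n A) (m : 'X_{1..n}).

Definition mps_const (a : A) : mpseries n A :=
  fun m => if m == 0%MM then a else 0.
Definition mps_one : mpseries n A := mps_const 1.
Definition mps_mul f g : mpseries n A := fun m =>
  \sum_(k : 'X_{1..n < (mdeg m).+1, (mdeg m).+1} | m == (k.1 + k.2)%MM)
     f k.1 * g k.2.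
Definition mps_var (i : 'I_n) : mpseries n A := fun m => (m == U_(i)%MM)%:R.

Definition mps_trunc d f : {mpoly A[n]} :=
  \sum_(a : 'X_{1..n < d}) f a *: 'X_[a].

Lemma mps_truncE d f m : (mdeg m < d)%N -> (mps_trunc d f)@_m = f m.
Proof.
move=> md; rewrite raddf_sum /= (bigD1 (BMultinom md)) //=.
rewrite mcoeffZ mcoeffX eqxx mulr1 big1 ?addr0 // => a ne.
rewrite mcoeffZ mcoeffX; case: eqP => [e|_]; last by rewrite mulr0.
by case/eqP: ne; apply: val_inj.
Qed.

Lemma mps_mulE d f g m : (mdeg m < d)%N ->
  mps_mul f g m = (mps_trunc d f * mps_trunc d g)@_m.
Proof.
move=> md; rewrite mcoeffM; apply: eq_bigr => k _.
have lt (b : 'X_{1..n < (mdeg m).+1}) : (mdeg b < d)%N.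
  by apply: leq_ltn_trans md; rewrite -ltnS bmdeg.
by rewrite !mps_truncE.
Qed.

Fact mps_mulC : commutative mps_mul.
Proof.
by move=> f g; apply/funext=> m; rewrite !(mps_mulE _ _ (ltnSn (mdeg m))) mulrC.
Qed.

Fact mps_mulA : associative mps_mul.
Proof.
move=> f g h; apply/funext=> m; set d := (mdeg m).+1.
have lt (b : 'X_{1..n < (mdeg m).+1}) : (mdeg b < d)%N by apply: bmdeg.
have md : (mdeg m < d)%N by [].
have -> : mps_mul f (mps_mul g h) m
        = (mps_trunc d f * (mps_trunc d g * mps_trunc d h))@_m.
  rewrite (mps_mulE _ _ md) 2!mcoeffM; apply: eq_bigr => k _.
  by rewrite -(mps_mulE _ _ (lt k.2)) (mps_truncE (mps_mul _ _) (lt k.2)).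
have -> : mps_mul (mps_mul f g) h m
        = ((mps_trunc d f * mps_trunc d g) * mps_trunc d h)@_m.
  rewrite (mps_mulE _ _ md) 2!mcoeffM; apply: eq_bigr => k _.
  by rewrite -(mps_mulE _ _ (lt k.1)) (mps_truncE (mps_mul _ _) (lt k.1)).
by rewrite mulrA.
Qed.

Fact mps_mul1 : left_id mps_one mps_mul.
Proof.
move=> f; apply/funext=> m; have md := ltnSn (mdeg m).
have e1 : mps_trunc (mdeg m).+1 mps_one = 1.
  apply/mpolyP => b; rewrite mcoeff1 raddf_sum /=.
  have z : (mdeg (0%MM : 'X_{1..n}) < (mdeg m).+1)%N by rewrite mdeg0.
  rewrite (bigD1 (BMultinom z)) //= mcoeffZ mcoeffX big1 ?addr0 => [|a ne].
    by rewrite /mps_one /mps_const eqxx mul1r eq_sym.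
  rewrite mcoeffZ /mps_one /mps_const; case: eqP => [e|_]; last exact: mul0r.
  by case/eqP: ne; apply: val_inj.
by rewrite (mps_mulE _ _ md) e1 mul1r mps_truncE.
Qed.

Fact mps_mulDl : left_distributive mps_mul +%R.
Proof.
move=> f g h; apply/funext=> m; transitivity (mps_mul f h m + mps_mul g h m) => //.
by rewrite /mps_mul -big_split; apply: eq_bigr => i _; apply: mulrDl.
Qed.

Fact mps_one_neq0 : mps_one != 0.
Proof.
apply/eqP => /(congr1 (fun f : mpseries n A => f 0%MM)) /eqP.
by rewrite /mps_one /mps_const eqxx oner_eq0.
Qed.

HB.instance Definition _ := GRing.Zmodule_isComNzRing.Build (mpseries n A)
  mps_mulA mps_mulC mps_mul1 mps_mulDl mps_one_neq0.

Definition mps_scale (a : A) f : mpseries n A := fun m => a * f m.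

Fact mps_scaleA a b f : mps_scale a (mps_scale b f) = mps_scale (a * b) f.
Proof. by apply/funext=> m; apply: mulrA. Qed.
Fact mps_scale1 : left_id 1 mps_scale.
Proof. by move=> f; apply/funext=> m; apply: mul1r. Qed.
Fact mps_scaleDr : right_distributive mps_scale +%R.
Proof. by move=> a f g; apply/funext=> m; apply: mulrDr. Qed.
Fact mps_scaleDl f : {morph mps_scale^~ f : a b / a + b}.
Proof. by move=> a b; apply/funext=> m; apply: mulrDl. Qed.

HB.instance Definition _ := GRing.Zmodule_isLmodule.Build A (mpseries n A)
  mps_scaleA mps_scale1 mps_scaleDr mps_scaleDl.

Fact mps_scaleAl a f g : a *: (f * g) = a *: f * g.
Proof.
apply/funext=> m; rewrite [LHS]big_distrr.
by apply: eq_bigr => i _; apply: mulrA.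
Qed.

HB.instance Definition _ :=
  GRing.LSemiModule_isLSemiAlgebra.Build A (mpseries n A) mps_scaleAl.
HB.instance Definition _ := GRing.Lalgebra_isComAlgebra.Build A (mpseries n A).

Lemma mps_coefM f g m : (f * g) m =
  \sum_(k : 'X_{1..n < (mdeg m).+1, (mdeg m).+1} | m == (k.1 + k.2)%MM)
     f k.1 * g k.2.
Proof. by []. Qed.

Lemma mps_coefZ a f m : (a *: f) m = a * f m.
Proof. by []. Qed.

End MPSeriesRing.

Section Substitution.
Variables (n : nat) (A : comNzRingType) (g : 'I_n -> pseries A).

(* The series f(g_1, ..., g_n). When every g_i has zero constant term, g^a has
   order at least |a|, so that only the monomials with |a| <= m contribute to
   the coefficient of t^m. *)
Definition mps_subst (f : mpseries n A) : pseries A := fun m =>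
  \sum_(a : 'X_{1..n < m.+1}) f a * (\prod_(i < n) g i ^+ a i) m.

Hypothesis g0 : forall i, g i 0%N = 0.

Let vanish d (u : pseries A) := forall m, (m < d)%N -> u m = 0.

Let vanishM c d u v : vanish c u -> vanish d v -> vanish (c + d) (u * v).
Proof.
move=> Hu Hv m lt; rewrite ps_coefM big1 // => i _.
have [ic|ci] := ltnP i c; first by rewrite Hu ?mul0r.
rewrite Hv ?mulr0 // ltn_subLR; last by rewrite -ltnS.
by apply: leq_trans lt _; rewrite leq_add2r.
Qed.

Let vanish_monom (a : 'X_{1..n}) : vanish (mdeg a) (mmap1 g a).
Proof.
rewrite /mmap1 mdegE.
apply: (big_ind2 (fun d u => vanish d u)) => [|c u d v|i _] //.
  exact: vanishM.
elim: (a i) => [|e IH] //; rewrite exprS -add1n; apply: vanishM => // m.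
by rewrite ltnS leqn0 => /eqP ->.
Qed.

Lemma mps_substE (f : mpseries n A) (F : {mpoly A[n]}) m :
  (forall a, (mdeg a <= m)%N -> F@_a = f a) ->
  mps_subst f m = mmap (in_alg (pseries A)) g F m.
Proof.
move=> HF; pose d := maxn m.+1 (msize F).
rewrite (@mmapE _ _ _ _ _ _ d) ?leq_maxr // ps_sumE.
pose G (a : 'X_{1..n}) := F@_a * mmap1 g a m.
rewrite (eq_bigr (fun a : 'X_{1..n < d} => G a)); last first.
  by move=> a _; rewrite /= mulr_algl.
rewrite /mps_subst (eq_bigr (fun a : 'X_{1..n < m.+1} => G a)); last first.
  by move=> a _; rewrite /G HF // -ltnS bmdeg.
rewrite [RHS](bigID (fun a : 'X_{1..n < d} => (mdeg a < m.+1)%N)) /=.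
rewrite [X in _ + X]big1 ?addr0; last first.
  by move=> a; rewrite -leqNgt => ma; rewrite /G vanish_monom ?mulr0.
have dm (a : 'X_{1..n < m.+1}) : (mdeg a < d)%N.
  by rewrite (leq_trans (bmdeg a)) ?leq_maxl.
pose w a : 'X_{1..n < d} := BMultinom (dm a).
pose z : 'X_{1..n < m.+1} := bm0.
rewrite (reindex_onto w (fun b => insubd z (val b))) /=.
  apply: eq_bigl => a; rewrite bmdeg /=; apply/esym/eqP/val_inj.
  by rewrite val_insubd /= bmdeg.
move=> b lt; apply: val_inj; rewrite /= val_insubd /=.
by rewrite lt.
Qed.

Let trunc_ok (f : mpseries n A) m a :
  (mdeg a <= m)%N -> (mps_trunc m.+1 f)@_a = f a.
Proof. by move=> am; rewrite mps_truncE. Qed.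

Fact mps_subst_zmod_morphism : zmod_morphism mps_subst.
Proof.
move=> f h; apply/funext => m.
rewrite (mps_substE (F := mps_trunc m.+1 f - mps_trunc m.+1 h)).
  rewrite rmorphB; transitivity (mps_subst f m - mps_subst h m) => //.
  by rewrite (mps_substE (@trunc_ok f m)) (mps_substE (@trunc_ok h m)).
by move=> a am; rewrite mcoeffB !trunc_ok.
Qed.

Fact mps_subst_monoid_morphism : monoid_morphism mps_subst.
Proof.
split.
  apply/funext => m; rewrite (mps_substE (F := 1)) ?rmorph1 // => a _.
  by rewrite mcoeff1; transitivity (mps_one A a) => //;
     rewrite /mps_one /mps_const; case: eqP.
move=> f h; apply/funext => m.
rewrite (mps_substE (F := mps_trunc m.+1 f * mps_trunc m.+1 h)); last first.
  by move=> a am; rewrite -mps_mulE.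
rewrite rmorphM !ps_coefM; apply: eq_bigr => i _.
congr (_ * _); apply/esym/mps_substE => a ai; rewrite trunc_ok //.
  by apply: leq_trans ai _; rewrite -ltnS.
by apply: leq_trans ai _; apply: leq_subr.
Qed.

Fact mps_subst_scalable : scalable mps_subst.
Proof.
move=> c f; apply/funext => m; rewrite ps_coefZ big_distrr.
by apply: eq_bigr => a _; apply/esym/mulrA.
Qed.

Lemma mps_subst_var i : mps_subst (mps_var A i) = g i.
Proof.
apply/funext => m; rewrite (mps_substE (F := 'X_i)).
  by rewrite mmapX mmap1U.
by move=> a _; rewrite mcoeffX eq_sym.
Qed.

End Substitution.

Definition branches (r : nat) (A : Type) : Type := {ffun 'I_r -> pseries A}.

(* For r = 0 this is the zero ring, hence only a [comPzRingType]. *)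
HB.instance Definition _ r (A : comNzRingType) :=
  GRing.PzRing.copy (branches r A) {ffun 'I_r -> pseries A}.

Fact branches_mulC r (A : comNzRingType) :
  commutative (@GRing.mul (branches r A)).
Proof. exact: ffun_mulC. Qed.

HB.instance Definition _ r (A : comNzRingType) :=
  GRing.PzRing_hasCommutativeMul.Build (branches r A) (@branches_mulC r A).
HB.instance Definition _ r (A : comNzRingType) :=
  GRing.Lmodule.copy (branches r A) {ffun 'I_r -> pseries A}.

Definition branch r A (j : 'I_r) (y : branches r A) : pseries A :=
  (y : {ffun 'I_r -> pseries A}) j.

Section Localization.
Variables (R : comPzRingType) (S : mulrClosed R).

Definition loc_pair := {x : R * R | x.2 \in (S : {pred R})}.
HB.instance Definition _ := Choice.on loc_pair.
Implicit Types (x y z : loc_pair).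

Definition loc_mk (a s : R) (Ss : s \in (S : {pred R})) : loc_pair :=
  exist (fun x : R * R => x.2 \in (S : {pred R})) (a, s) Ss.
Definition loc_num x : R := (val x).1.
Definition loc_den x : R := (val x).2.

Lemma loc_denP x : loc_den x \in (S : {pred R}).
Proof. exact: valP x. Qed.

(* (a, s) ~ (b, t) when u (a t - b s) = 0 for some u in S. *)
Definition loc_equiv x y : bool :=
  `[< exists2 u, u \in (S : {pred R}) &
        u * (loc_num x * loc_den y) = u * (loc_num y * loc_den x) >].

Fact loc_equiv_refl : reflexive loc_equiv.
Proof. by move=> x; apply/asboolP; exists 1; rewrite ?rpred1. Qed.

Fact loc_equiv_sym : ssrbool.symmetric loc_equiv.
Proof.
by move=> x y; apply/asboolP/asboolP => -[u Su e]; exists u.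
Qed.

Fact loc_equiv_trans : transitive loc_equiv.
Proof.
move=> y x z /asboolP[u Su xy] /asboolP[v Sv yz]; apply/asboolP.
exists (u * v * loc_den y); first by rewrite !rpredM ?loc_denP.
transitivity ((v * loc_den z) * (u * (loc_num x * loc_den y))); first ring.
rewrite xy.
transitivity ((u * loc_den x) * (v * (loc_num y * loc_den z))); first ring.
by rewrite yz; ring.
Qed.

Canonical loc_equiv_equiv :=
  EquivRel loc_equiv loc_equiv_refl loc_equiv_sym loc_equiv_trans.

Definition loc := {eq_quot loc_equiv}.
HB.instance Definition _ : EqQuotient _ loc_equiv loc := EqQuotient.on loc.
HB.instance Definition _ := Choice.on loc.

Definition loc_frac (a s : R) (Ss : s \in (S : {pred R})) : loc :=
  \pi_loc (loc_mk a Ss).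
Definition loc_add x y : loc_pair :=
  loc_mk (loc_num x * loc_den y + loc_num y * loc_den x)
         (rpredM (loc_denP x) (loc_denP y)).
Definition loc_opp x : loc_pair := loc_mk (- loc_num x) (loc_denP x).
Definition loc_mul x y : loc_pair :=
  loc_mk (loc_num x * loc_num y) (rpredM (loc_denP x) (loc_denP y)).

Lemma loc_eqP x y :
  reflect (exists2 u, u \in (S : {pred R}) &
             u * (loc_num x * loc_den y) = u * (loc_num y * loc_den x))
          (x == y %[mod loc]).
Proof. by rewrite eqmodE; apply: asboolP. Qed.

Let piP x y u : u \in (S : {pred R}) ->
  u * (loc_num x * loc_den y) = u * (loc_num y * loc_den x) ->
  \pi_loc x = \pi_loc y.
Proof. by move=> Su e; apply/eqP/loc_eqP; exists u. Qed.

Let repr_loc x : exists2 u, u \in (S : {pred R}) &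
  u * (loc_num (repr (\pi_loc x)) * loc_den x)
  = u * (loc_num x * loc_den (repr (\pi_loc x))).
Proof. by apply/loc_eqP; rewrite reprK. Qed.

Definition locD := lift_op2 loc loc_add.
Definition locN := lift_op1 loc loc_opp.
Definition locM := lift_op2 loc loc_mul.

Fact pi_locD : {morph \pi_loc : x y / loc_add x y >-> locD x y}.
Proof.
move=> x y; unlock locD; have [u Su ex] := repr_loc x.
have [v Sv ey] := repr_loc y; symmetry; apply: (piP (rpredM Su Sv)).
rewrite /loc_add /loc_num /loc_den /=; rewrite /loc_num /loc_den in ex ey.
move: (repr (\pi_loc x)) (repr (\pi_loc y)) ex ey.
move: x y => [[a s] _] [[b t] _] [[a' s'] _] [[b' t'] _] /= ex ey.
transitivity ((u * (a' * s)) * (v * (t * t')) + (v * (b' * t)) * (u * (s * s'))).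
  by ring.
by rewrite ex ey; ring.
Qed.
Canonical pi_locD_morph := PiMorph2 pi_locD.

Fact pi_locN : {morph \pi_loc : x / loc_opp x >-> locN x}.
Proof.
move=> x; unlock locN; have [u Su ex] := repr_loc x.
symmetry; apply: (piP Su).
rewrite /loc_opp {1 3}/loc_num /= /loc_den /= -/(loc_den _) -/(loc_den _).
by rewrite !mulNr !mulrN ex.
Qed.
Canonical pi_locN_morph := PiMorph1 pi_locN.

Fact pi_locM : {morph \pi_loc : x y / loc_mul x y >-> locM x y}.
Proof.
move=> x y; unlock locM; have [u Su ex] := repr_loc x.
have [v Sv ey] := repr_loc y; symmetry; apply: (piP (rpredM Su Sv)).
rewrite /loc_mul /loc_num /loc_den /=; rewrite /loc_num /loc_den in ex ey.
move: (repr (\pi_loc x)) (repr (\pi_loc y)) ex ey.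
move: x y => [[a s] _] [[b t] _] [[a' s'] _] [[b' t'] _] /= ex ey.
transitivity ((u * (a' * s)) * (v * (b' * t))); first by ring.
by rewrite ex ey; ring.
Qed.
Canonical pi_locM_morph := PiMorph2 pi_locM.

Definition loc_inj (a : R) : loc := loc_frac a (rpred1 S).

Fact locDA : associative locD.
Proof.
elim/quotW=> x; elim/quotW=> y; elim/quotW=> z; rewrite -!pi_locD.
apply: (piP (rpred1 S)).
by rewrite /loc_add /loc_opp /loc_mul /loc_mk /loc_num /loc_den /=; ring.
Qed.

Fact locDC : commutative locD.
Proof.
elim/quotW=> x; elim/quotW=> y; rewrite -!pi_locD.
apply: (piP (rpred1 S)).
by rewrite /loc_add /loc_opp /loc_mul /loc_mk /loc_num /loc_den /=; ring.
Qed.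

Fact loc0D : left_id (loc_inj 0) locD.
Proof.
elim/quotW=> x; rewrite /loc_inj /loc_frac -!pi_locD.
apply: (piP (rpred1 S)).
by rewrite /loc_add /loc_opp /loc_mul /loc_mk /loc_num /loc_den /=; ring.
Qed.

Fact locND : left_inverse (loc_inj 0) locN locD.
Proof.
elim/quotW=> x; rewrite /loc_inj /loc_frac -?pi_locN -pi_locD.
apply: (piP (rpred1 S)).
by rewrite /loc_add /loc_opp /loc_mul /loc_mk /loc_num /loc_den /=; ring.
Qed.

HB.instance Definition _ := GRing.isZmodule.Build loc locDA locDC loc0D locND.

Fact locMA : associative locM.
Proof.
elim/quotW=> x; elim/quotW=> y; elim/quotW=> z; rewrite -!pi_locM.
apply: (piP (rpred1 S)).
by rewrite /loc_add /loc_opp /loc_mul /loc_mk /loc_num /loc_den /=; ring.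
Qed.

Fact locMC : commutative locM.
Proof.
elim/quotW=> x; elim/quotW=> y; rewrite -!pi_locM.
apply: (piP (rpred1 S)).
by rewrite /loc_add /loc_opp /loc_mul /loc_mk /loc_num /loc_den /=; ring.
Qed.

Fact loc1M : left_id (loc_inj 1) locM.
Proof.
elim/quotW=> x; rewrite /loc_inj /loc_frac -!pi_locM.
apply: (piP (rpred1 S)).
by rewrite /loc_add /loc_opp /loc_mul /loc_mk /loc_num /loc_den /=; ring.
Qed.

Fact locMDl : left_distributive locM locD.
Proof.
elim/quotW=> x; elim/quotW=> y; elim/quotW=> z.
rewrite -!(pi_locM, pi_locD).
apply: (piP (rpred1 S)).
by rewrite /loc_add /loc_opp /loc_mul /loc_mk /loc_num /loc_den /=; ring.
Qed.

HB.instance Definition _ :=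
  GRing.Zmodule_isComPzRing.Build loc locMA locMC loc1M locMDl.

Fact loc_inj_zmod_morphism : zmod_morphism loc_inj.
Proof.
move=> a b; transitivity (locD (loc_inj a) (locN (loc_inj b))) => //.
rewrite /loc_inj /loc_frac -?pi_locN -pi_locD.
apply: (piP (rpred1 S)).
by rewrite /loc_add /loc_opp /loc_mul /loc_mk /loc_num /loc_den /=; ring.
Qed.

Fact loc_inj_monoid_morphism : monoid_morphism loc_inj.
Proof.
split=> // a b; transitivity (locM (loc_inj a) (loc_inj b)) => //.
rewrite /loc_inj /loc_frac -pi_locM.
apply: (piP (rpred1 S)).
by rewrite /loc_add /loc_opp /loc_mul /loc_mk /loc_num /loc_den /=; ring.
Qed.

HB.instance Definition _ :=
  GRing.isZmodMorphism.Build R loc loc_inj loc_inj_zmod_morphism.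
HB.instance Definition _ :=
  GRing.isMonoidMorphism.Build R loc loc_inj loc_inj_monoid_morphism.

Lemma loc_frac_eq a s (Ss : s \in (S : {pred R}))
    b t (St : t \in (S : {pred R})) :
  loc_frac a Ss = loc_frac b St <->
  exists2 u, u \in (S : {pred R}) & u * (a * t) = u * (b * s).
Proof. by split=> [/eqP/loc_eqP //|h]; apply/eqP/loc_eqP. Qed.

Lemma loc_fracM a s (Ss : s \in (S : {pred R}))
    b t (St : t \in (S : {pred R})) :
  loc_frac a Ss * loc_frac b St = loc_frac (a * b) (rpredM Ss St).
Proof.
transitivity (locM (loc_frac a Ss) (loc_frac b St)) => //.
rewrite /loc_inj /loc_frac -pi_locM.
apply: (piP (rpred1 S)).
by rewrite /loc_add /loc_opp /loc_mul /loc_mk /loc_num /loc_den /=; ring.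
Qed.

Lemma loc_fracD a s (Ss : s \in (S : {pred R}))
    b t (St : t \in (S : {pred R})) :
  loc_frac a Ss + loc_frac b St = loc_frac (a * t + b * s) (rpredM Ss St).
Proof.
transitivity (locD (loc_frac a Ss) (loc_frac b St)) => //.
rewrite /loc_inj /loc_frac -pi_locD.
apply: (piP (rpred1 S)).
by rewrite /loc_add /loc_opp /loc_mul /loc_mk /loc_num /loc_den /=; ring.
Qed.

Lemma loc_fracP (z : loc) :
  exists a s (Ss : s \in (S : {pred R})), z = loc_frac a Ss.
Proof.
elim/quotW: z => -[[a s] Ss]; exists a, s, Ss.
by apply: (piP (rpred1 S)).
Qed.

End Localization.

Definition Spec (A : comNzRingType) : Type := prime_idealr A.

(* U is the complement of V(E) for some subset E of A. *)
Definition zariski_open (A : comNzRingType) (U : Spec A -> Prop) : Prop :=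
  exists E : A -> Prop, forall q : Spec A,
    U q <-> ~ (forall a, E a -> a \in (q : {pred A})).

(* Ideals of A are the submodules of the regular module A^o. *)
Definition noetherian (A : comNzRingType) : Prop :=
  forall I : {pred A^o}, submod_closed I ->
    exists s : seq A, forall a : A,
      (a \in I) <-> exists c : 'I_(size s) -> A, a = \sum_i c i * s`_i.

Section ResidueField.
Variables (A : comNzRingType) (q : Spec A).

Definition prime_compl : {pred A} := [predC (q : {pred A})].

Fact prime_compl_mulr_closed : mulr_closed prime_compl.
Proof.
split=> [|a b]; rewrite !inE ?idealr1 //.
by rewrite prime_idealrM => /negbTE-> /negbTE->.
Qed.

HB.instance Definition _ :=
  GRing.isMulClosed.Build A prime_compl prime_compl_mulr_closed.

Definition local_ring : Type := loc prime_compl.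
HB.instance Definition _ := GRing.ComPzRing.on local_ring.

Fact local_ring_one_neq0 : (1 : local_ring) != 0.
Proof.
apply/eqP => /loc_frac_eq[u Su]; rewrite !mulr1 mulr0 => u0.
by move: Su; rewrite u0 inE idealr0.
Qed.

HB.instance Definition _ :=
  GRing.PzSemiRing_isNonZero.Build local_ring local_ring_one_neq0.

Definition local_max : {pred local_ring} := fun z =>
  `[< exists a s (Ss : s \in prime_compl),
        a \in (q : {pred A}) /\ z = loc_frac a Ss >].

Lemma local_maxP a s (Ss : s \in prime_compl) :
  (loc_frac a Ss : local_ring) \in local_max <-> a \in (q : {pred A}).
Proof.
split=> [/asboolP[b [t [St [qb]]]]|qa]; last first.
  by apply/asboolP; exists a, s, Ss.
move=> /loc_frac_eq[u Su e].
have : u * (a * t) \in (q : {pred A}) by rewrite e idealMr // mulrC idealMr.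
rewrite !prime_idealrM; move: Su St; rewrite !inE => /negbTE-> /negbTE->.
by rewrite orbF.
Qed.

Fact local_max_idealr_closed : idealr_closed local_max.
Proof.
split.
- by apply/local_maxP; rewrite idealr0.
- by apply/negP => /local_maxP; rewrite idealr1.
move=> z x y; have [c [w [Sw ->]]] := loc_fracP z.
move=> /asboolP[a [s [Ss [qa ->]]]] /asboolP[b [t [St [qb ->]]]].
rewrite loc_fracM loc_fracD; apply/local_maxP.
by apply: rpredD; rewrite mulrC !idealMr.
Qed.

HB.instance Definition _ :=
  isIdealr.Build local_ring local_max local_max_idealr_closed.

(* k(q) = A_q / q A_q *)
Definition residue_field : Type := {ideal_quot local_max}.
HB.instance Definition _ := GRing.ComNzRing.on residue_field.

Definition residue_inv (z : residue_field) : residue_field :=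
  if pselect (exists w, w * z = 1) is left h then projT1 (cid h) else 0.

Fact residue_mulVf z : z != 0 -> residue_inv z * z = 1.
Proof.
rewrite /residue_inv; case: pselect => [h|nh nz]; first by case: (cid h).
case: nh; move: nz; elim/quotW: z => x; have [a [s [Ss ->]]] := loc_fracP x.
rewrite -(rmorph0 (\pi_({ideal_quot local_max}))) -Quotient.idealrBE subr0 => nqa.
have qa : a \in prime_compl by rewrite inE; apply: contraNN nqa => /local_maxP->.
exists (\pi_({ideal_quot local_max}) (loc_frac s qa : local_ring)).
rewrite -rmorphM -(rmorph1 (\pi_({ideal_quot local_max}))); congr (\pi _).
by rewrite loc_fracM; apply/loc_frac_eq; exists 1; rewrite ?rpred1 //; ring.
Qed.

Fact residue_inv0 : residue_inv 0 = 0.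
Proof.
rewrite /residue_inv; case: pselect => // h; exfalso; case: h => w.
by rewrite mulr0 => /esym/eqP; rewrite oner_eq0.
Qed.

HB.instance Definition _ :=
  GRing.ComNzRing_isField.Build residue_field residue_mulVf residue_inv0.

Definition to_residue (a : A) : residue_field :=
  \pi_({ideal_quot local_max}) (loc_inj prime_compl a : local_ring).

Fact to_residue_zmod_morphism : zmod_morphism to_residue.
Proof. by move=> a b; rewrite /to_residue !rmorphB. Qed.

Fact to_residue_monoid_morphism : monoid_morphism to_residue.
Proof. by split=> [|a b]; rewrite /to_residue ?rmorph1 ?rmorphM. Qed.

HB.instance Definition _ := GRing.isZmodMorphism.Build A residue_field
  to_residue to_residue_zmod_morphism.
HB.instance Definition _ := GRing.isMonoidMorphism.Build A residue_field
  to_residue to_residue_monoid_morphism.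

End ResidueField.

Section TotalQuotient.
Variable R : comPzRingType.

Definition nonzerodivisor : {pred R} :=
  fun s => `[< forall x, s * x = 0 -> x = 0 >].

Fact nonzerodivisor_mulr_closed : mulr_closed nonzerodivisor.
Proof.
split=> [|s t /asboolP Hs /asboolP Ht]; apply/asboolP => x.
  by rewrite mul1r.
by rewrite -mulrA => /Hs/Ht.
Qed.

HB.instance Definition _ :=
  GRing.isMulClosed.Build R nonzerodivisor nonzerodivisor_mulr_closed.

Definition total_quotient : Type := loc nonzerodivisor.
HB.instance Definition _ := GRing.ComPzRing.on total_quotient.

Definition to_total_quotient : R -> total_quotient := loc_inj nonzerodivisor.
HB.instance Definition _ := GRing.RMorphism.on to_total_quotient.

End TotalQuotient.

(* z is a root of a monic polynomial with coefficients in the image of f. The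
   library's [integralOver] is only available over nonzero rings. *)
Definition integral_over (R K : comPzRingType) (f : R -> K) (z : K) : Prop :=
  exists (d : nat) (c : 'I_d -> R),
    z ^+ d + \sum_(i < d) f (c i) * z ^+ i = 0.

Definition integral_closure (R : comPzRingType) (z : total_quotient R) : Prop :=
  integral_over (@to_total_quotient R) z.

(* f identifies S, as an R-algebra, with the integral closure of R in its total
   quotient ring; f is then injective, as R embeds in its total quotient ring. *)
Definition is_normalization (R S : comPzRingType) (f : R -> S) : Prop :=
  exists g : {rmorphism S -> total_quotient R},
    [/\ injective g,
        forall x, g (f x) = to_total_quotient x &
        forall z, integral_closure z <-> exists y, g y = z].

(* The classes of v_0, ..., v_(d-1) form a k-basis of V / W. Here W is contained
   in V, both are k-subspaces of E, and [scal] is the action of k on E. *)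
Definition basis_mod (k : fieldType) (E : zmodType) (scal : k -> E -> E)
    (V W : E -> Prop) (d : nat) (v : 'I_d -> E) : Prop :=
  (forall i, V (v i)) /\
  (forall x, V x -> exists! c : 'I_d -> k, W (x - \sum_i scal (c i) (v i))).

(* dim_k (V / W), with [None] for an infinite dimension. *)
Definition dim_mod (k : fieldType) (E : zmodType) (scal : k -> E -> E)
    (V W : E -> Prop) : option nat :=
  if pselect (exists (d : nat) (v : 'I_d -> E), basis_mod scal V W v) is left h
  then Some (projT1 (cid h)) else None.

Definition dim_le (a b : option nat) : bool :=
  match a, b with
  | _, None => true
  | None, Some _ => false
  | Some x, Some y => (x <= y)%N
  end.

(* The integral closure and R are compared inside the total quotient ring, on
   which k acts through f : k -> R. *)
Definition delta (k : fieldType) (R : comPzRingType) (f : k -> R) : option nat :=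
  dim_mod (fun (c : k) (z : total_quotient R) => to_total_quotient (f c) * z)
    (@integral_closure R) (fun z => exists x : R, to_total_quotient x = z).

(* Ker(psi_j), where psi_j is the j-th component of psi. *)
Definition branch_ker (n r : nat) (A : comNzRingType)
    (psi : mpseries n A -> branches r A) (j : 'I_r) : mpseries n A -> Prop :=
  fun f => branch j (psi f) = 0.

Record param_family (A : comNzRingType) (n r : nat) := ParamFamily {
  family_mor :> {lrmorphism mpseries n A -> branches r A};
  family_var0 : forall (i : 'I_n) (j : 'I_r),
    branch j (family_mor (mps_var A i)) 0%N = 0;
  family_ker : forall j j' : 'I_r,
    j <> j' -> branch_ker family_mor j <> branch_ker family_mor j'
}.

Section Induced.
Variables (A : comNzRingType) (n r : nat) (phi : param_family A n r).
Variable q : Spec A.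
Local Notation k := (residue_field q).

(* The j-th component of phi_A(x_i), with its coefficients mapped to k(q). *)
Definition induced_var (j : 'I_r) (i : 'I_n) : pseries k :=
  fun m => to_residue q (branch j (phi (mps_var A i)) m).

Definition induced (f : mpseries n k) : branches r k :=
  [ffun j => mps_subst (induced_var j) f].

Fact induced_var0 j i : induced_var j i 0%N = 0.
Proof. by rewrite /induced_var family_var0 rmorph0. Qed.

Fact induced_zmod_morphism : zmod_morphism induced.
Proof.
move=> f g; apply/ffunP => j; rewrite !ffunE.
exact: (mps_subst_zmod_morphism (induced_var0 j)).
Qed.

Fact induced_monoid_morphism : monoid_morphism induced.
Proof.
split=> [|f g]; apply/ffunP => j; rewrite !ffunE;
  by have [H1 HM] := mps_subst_monoid_morphism (induced_var0 j).
Qed.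

Fact induced_scalable : scalable induced.
Proof.
by move=> c f; apply/ffunP => j; rewrite !ffunE mps_subst_scalable.
Qed.

HB.instance Definition _ := GRing.isZmodMorphism.Build
  (mpseries n k) (branches r k) induced induced_zmod_morphism.
HB.instance Definition _ := GRing.isMonoidMorphism.Build
  (mpseries n k) (branches r k) induced induced_monoid_morphism.
HB.instance Definition _ := GRing.isScalable.Build
  k (mpseries n k) (branches r k) *:%R induced induced_scalable.

Lemma induced_varE i j m :
  branch j (induced (mps_var k i)) m
  = to_residue q (branch j (phi (mps_var A i)) m).
Proof. by rewrite /branch ffunE mps_subst_var //; apply: induced_var0. Qed.

(* R_q, realized as the image of phi_q (isomorphic to P_q / Ker phi_q). *)
Definition curve_pred : {pred branches r k} :=
  fun y => `[< exists f, induced f = y >].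

Fact curve_pred_subring_closed : subring_closed curve_pred.
Proof.
split=> [|_ _ /asboolP[f <-] /asboolP[g <-]|_ _ /asboolP[f <-] /asboolP[g <-]].
- by apply/asboolP; exists 1; rewrite rmorph1.
- by apply/asboolP; exists (f - g); rewrite rmorphB.
- by apply/asboolP; exists (f * g); rewrite rmorphM.
Qed.

HB.instance Definition _ := GRing.isSubringClosed.Build
  (branches r k) curve_pred curve_pred_subring_closed.

Definition curve_ring : Type := {y : branches r k | y \in curve_pred}.
HB.instance Definition _ := SubChoice.on curve_ring.
HB.instance Definition _ := GRing.SubChoice_isSubComPzRing.Build
  (branches r k) curve_pred curve_ring curve_pred_subring_closed.

Definition curve_incl (x : curve_ring) : branches r k := val x.
HB.instance Definition _ := GRing.RMorphism.copy curve_incl val.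

Fact curve_scalar_subproof (c : k) : c *: (1 : branches r k) \in curve_pred.
Proof. by apply/asboolP; exists (c *: 1); rewrite linearZ rmorph1. Qed.

Definition curve_scalar (c : k) : curve_ring :=
  exist (fun y => y \in curve_pred) (c *: (1 : branches r k)) (curve_scalar_subproof c).

End Induced.

(* The image of psi is automatically reduced, as a subring of a product of
   domains. *)
Definition is_parameterization (n r : nat) (K : fieldType)
    (psi : mpseries n K -> branches r K) : Prop :=
  (forall j : 'I_r, exists i : 'I_n, branch j (psi (mps_var K i)) <> 0) /\
  (forall j j' : 'I_r, j <> j' -> branch_ker psi j <> branch_ker psi j').

Definition branches_codim (A : comNzRingType) (n r : nat)
    (phi : param_family A n r) (q : Spec A) : option nat :=
  dim_mod (fun (c : residue_field q) (y : branches r (residue_field q)) =>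
             c *: y)
    (fun _ => True) (fun y => exists x, curve_incl (phi := phi) x = y).

Definition curve_delta (A : comNzRingType) (n r : nat)
    (phi : param_family A n r) (q : Spec A) : option nat :=
  delta (curve_scalar phi (q := q)).

Definition upper_semicontinuous_on (A : comNzRingType) (U : Spec A -> Prop)
    (d : Spec A -> option nat) : Prop :=
  forall p' : Spec A, U p' ->
    exists U' : Spec A -> Prop,
      [/\ zariski_open U', U' p', forall q, U' q -> U q &
          forall q, U' q -> dim_le (d q) (d p')].

(* Main.v *)
From HB Require Import structures.
Require Import Defs.
From mathcomp Require Import all_boot all_order all_algebra.
From mathcomp Require Import boolp mpoly ring zify.

Set Implicit Arguments.
Unset Strict Implicit.
Unset Printing Implicit Defensive.

Import GRing.Theory.
Local Open Scope ring_scope.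
Local Open Scope quotient_scope.

(** Write R_q for the image of the parameterization at q and S_q for the product
    of the k(q)[[t_j]]. The heart of the matter is a bound for the conductor
    which is uniform near p: a single M such that t^M S_q is contained in R_q for all q in
    a neighbourhood of p. Inclusion of t^M S_p in R_p modulo a higher power of t is not
    an open condition, because R_q may have different orders than R_p; what does
    propagate is a lower bound for the rank of a matrix over A.

    Let d be the codimension of R_p in S_p. Choose u, a sum of powers of the
    coordinates, that is nonzero on every branch at p, say of order at most w
    ([exists_uniform_powers]). The coefficients that witness this stay nonzero near p.
    Put N = d + 1 and M = N w. Modulo t^M, the ring R_q is spanned by the images of
    the monomials of degree less than M, so its codimension is M r minus the rank
    of a matrix which is the specialization at q of a matrix over A. Ranks can only
    go up near p ([rank_principal_open]), so the codimension of R_q + t^M S_q in S_q is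
    at most d near p. As u^N S_q contains t^M S_q, the inclusions in the chain of the
    R_q + u^i S_q, for i = 0, ..., N, cannot all be strict ([chain_stationary]): some
    u^i S_q with i < N is contained in R_q + u^(i+1) S_q. Iterating this and summing
    the resulting series in k(q)[[x]] gives that u^i S_q is contained in R_q
    ([image_of_stationary]), whence t^M S_q is contained in R_q.

    Once t^M S_q is contained in R_q, fractions with denominator a power of t
    identify S_q with a subring of the total quotient ring of R_q. Its elements are
    integral over R_q, and it is integrally closed, being a product of discrete
    valuation rings; so S_q is the normalization ([normalization_of_conductor]).
    Then delta at q is the codimension of R_q in S_q, which is computed modulo t^M
    with the same M for all q, hence equals M r minus a rank
    ([curve_delta_rank]); semicontinuity of ranks gives that of delta. *)

(** * Orders of power series *)

(** Membership in the ideal generated by t^d. *)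
Definition ps_vanish (A : comNzRingType) (d : nat) (f : pseries A) : Prop :=
  forall m, (m < d)%N -> f m = 0.

Lemma ps_vanish_le (A : comNzRingType) c d (f : pseries A) :
  (c <= d)%N -> ps_vanish d f -> ps_vanish c f.
Proof. by move=> cd vf m mc; apply: vf; apply: leq_trans cd. Qed.

Lemma ps_vanish_eq0 (A : comNzRingType) (f : pseries A) :
  (forall d, ps_vanish d f) -> f = 0.
Proof. by move=> vf; apply/funext=> m; apply: (vf m.+1). Qed.

Lemma ps_vanishN (A : comNzRingType) d (f : pseries A) :
  ps_vanish d f -> ps_vanish d (- f).
Proof. by move=> vf m md; transitivity (- f m) => //; rewrite vf ?oppr0. Qed.

Lemma ps_vanishD (A : comNzRingType) d (f h : pseries A) :
  ps_vanish d f -> ps_vanish d h -> ps_vanish d (f + h).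
Proof.
move=> vf vh m md; transitivity (f m + h m) => //.
by rewrite vf ?vh ?addr0.
Qed.

Lemma ps_vanish_sum (A : comNzRingType) I (s : seq I) (P : pred I) d
    (F : I -> pseries A) :
  (forall i, P i -> ps_vanish d (F i)) -> ps_vanish d (\sum_(i <- s | P i) F i).
Proof.
move=> vF; elim/big_rec: _ => [|i f Pi] //; exact: ps_vanishD (vF i Pi).
Qed.

Lemma ps_orderP (A : comNzRingType) (f : pseries A) w :
  f w != 0 -> exists v, [/\ (v <= w)%N, f v != 0 & ps_vanish v f].
Proof.
move=> fw; have ex : exists m, f m != 0 by exists w.
case: (ex_minnP ex) => v fv min; exists v; split => // [|m mv]; first exact: min.
by apply/eqP; apply: contraTT mv => /min; rewrite -leqNgt.
Qed.

Section Order.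
Variable A : comNzRingType.
Implicit Types f h : pseries A.

Lemma ps_vanishM c d f h :
  ps_vanish c f -> ps_vanish d h -> ps_vanish (c + d) (f * h).
Proof.
move=> vf vh m mcd; rewrite ps_coefM big1 // => i _.
have [ic|ci] := ltnP i c; first by rewrite vf ?mul0r.
by rewrite vh ?mulr0 //; have := ltn_ord i; lia.
Qed.

Lemma ps_lead_coefM c d f h :
  ps_vanish c f -> ps_vanish d h -> (f * h) (c + d)%N = f c * h d.
Proof.
move=> vf vh; have lt : (c < (c + d).+1)%N by lia.
rewrite ps_coefM (bigD1 (Ordinal lt)) //= addKn big1 ?addr0 // => i.
rewrite -val_eqE /= => ne; have [ic|ci] := ltnP i c; first by rewrite vf ?mul0r.
by rewrite vh ?mulr0 //; have := ltn_ord i; lia.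
Qed.

Lemma ps_vanishX c e f : ps_vanish c f -> ps_vanish (e * c) (f ^+ e).
Proof.
move=> vf; elim: e => [|e IH] //.
by rewrite exprS mulSn; apply: ps_vanishM.
Qed.

Lemma ps_lead_coefX c e f : ps_vanish c f -> (f ^+ e) (e * c)%N = f c ^+ e.
Proof.
move=> vf; elim: e => [|e IH]; first by rewrite !expr0 ps_coef1.
by rewrite !exprS mulSn ps_lead_coefM ?IH //; apply: ps_vanishX.
Qed.

Lemma ps_vanishMl d f h : ps_vanish d h -> ps_vanish d (f * h).
Proof. by move=> vh; rewrite -[d]add0n; apply: ps_vanishM. Qed.

Definition ps_monom (c : nat) : pseries A := fun m => (m == c)%:R.

Lemma ps_vanish_monom c : ps_vanish c (ps_monom c).
Proof. by move=> m; rewrite /ps_monom ltn_neqAle => /andP[/negbTE->]. Qed.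

Lemma ps_coef_monomM c f m : (ps_monom c * f) (c + m)%N = f m.
Proof.
have lt : (c < (c + m).+1)%N by lia.
rewrite ps_coefM (bigD1 (Ordinal lt)) //= addKn /ps_monom eqxx mul1r.
rewrite big1 ?addr0 // => i; rewrite -val_eqE /= => /negbTE->.
by rewrite mul0r.
Qed.

Lemma ps_monomM_eq0 c f : ps_monom c * f = 0 -> f = 0.
Proof.
by move=> e; apply/funext=> m; rewrite -(ps_coef_monomM c) e.
Qed.

Lemma ps_monom_factor c f : ps_vanish c f ->
  f = ps_monom c * (fun m => f (c + m)%N).
Proof.
move=> vf; apply/funext=> m; have [mc|cm] := ltnP m c.
  by rewrite vf // mulrC (ps_vanishMl _ (@ps_vanish_monom c)).
by rewrite -{2}(subnKC cm) ps_coef_monomM subnKC.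
Qed.

(** Geometric series: f^l has order at least l, so the sum of the f^l converges
    coefficientwise. *)
Lemma ps_one_sub_unit f : f 0%N = 0 -> exists h, (1 - f) * h = 1.
Proof.
move=> f0; have v1 : ps_vanish 1 f by case.
have vX l : ps_vanish l (f ^+ l) by rewrite -[X in ps_vanish X]muln1; apply: ps_vanishX.
pose h : pseries A := fun m => \sum_(l < m.+1) (f ^+ l) m.
have hS L : ps_vanish L (h - \sum_(l < L) f ^+ l).
  move=> m mL; transitivity (h m - (\sum_(l < L) f ^+ l) m) => //.
  apply/eqP; rewrite subr_eq0 ps_sumE; apply/eqP.
  rewrite /h -(subnKC mL) big_split_ord /= [X in _ = _ + X]big1 ?addr0 // => l _.
  by rewrite vX //=; lia.
exists h; apply/eqP; rewrite -subr_eq0; apply/eqP/ps_vanish_eq0 => L.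
have -> : (1 - f) * h - 1 = (1 - f) * (h - \sum_(l < L) f ^+ l) - f ^+ L.
  have e : (1 - f) * (\sum_(l < L) f ^+ l) = 1 - f ^+ L.
    by rewrite -[LHS]opprK -mulNr opprB -subrX1 opprB.
  by rewrite mulrBr e; ring.
by apply: ps_vanishD; [apply: ps_vanishMl | apply: ps_vanishN].
Qed.

End Order.

Section OrderField.
Variable K : fieldType.
Implicit Types f h : pseries K.

(** k[[t]] is a discrete valuation ring: [f] is a power of t, of exponent at most
    [w], times a unit. Only an upper bound for the order of [f] is asked for,
    because orders may drop when a family is specialized. *)
Lemma ps_divides w f h : f w != 0 -> ps_vanish w h -> exists y, h = f * y.
Proof.
move=> /ps_orderP[v [vw fv vf]] /(ps_vanish_le vw) vh.
pose f' : pseries K := fun m => f (v + m)%N.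
have [y ey] : exists y, f' * y = 1.
  have [y ey] : exists y, (1 - (1 - (f v)^-1 *: f')) * y = 1.
    apply: ps_one_sub_unit.
    transitivity ((1 : pseries K) 0%N - (f v)^-1 * f (v + 0)%N) => //.
    by rewrite ps_coef1 addn0 mulVf ?subrr.
  exists ((f v)^-1 *: y); rewrite -ey -scalerAr scalerAl.
  by rewrite [1 - (1 - _)]subKr.
pose h' : pseries K := fun m => h (v + m)%N.
exists (y * h'); have -> : f = ps_monom K v * f' := ps_monom_factor vf.
have -> : h = ps_monom K v * h' := ps_monom_factor vh.
by rewrite -[RHS]mulrA [f' * _]mulrA ey mul1r.
Qed.

(** k[[t]] is integrally closed: the hypothesis is the equation of integral
    dependence of a / s, with the denominators cleared. *)
Lemma ps_integral_order w d (s a : pseries K) (c : 'I_d -> pseries K) :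
  ps_vanish w s ->
  a ^+ d + \sum_(i < d) c i * (s ^+ (d - i) * a ^+ i) = 0 -> ps_vanish w a.
Proof.
move=> vs e.
suff H m : (m <= w)%N -> ps_vanish m a by apply: H.
elim: m => [|m IH] mw //.
have va := IH (ltnW mw) => i; rewrite ltnS leq_eqVlt => /orP[/eqP->|]; last exact: va.
apply/eqP; apply/negPn/negP => nz.
(* If a has order m < w, then a^d has order d m, and every other term has a
   larger order. *)
suff : (a ^+ d) (d * m)%N = 0.
  by rewrite ps_lead_coefX // => /eqP; rewrite expf_eq0 (negbTE nz) andbF.
have -> : a ^+ d = - \sum_(i < d) c i * (s ^+ (d - i) * a ^+ i).
  by apply/eqP; rewrite -addr_eq0 e.
have vS : ps_vanish (d * m).+1 (\sum_(i < d) c i * (s ^+ (d - i) * a ^+ i)).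
  apply: ps_vanish_sum => j _; apply: ps_vanishMl.
  have lt : ((d * m).+1 <= (d - j) * m.+1 + j * m)%N by have := ltn_ord j; nia.
  apply: ps_vanish_le lt _; apply: ps_vanishM; apply: ps_vanishX => //.
  exact: ps_vanish_le vs.
exact: (ps_vanishN vS).
Qed.

Lemma exists_order (f : pseries K) :
  exists o, f = 0 \/ ps_vanish o f /\ f o != 0.
Proof.
have [->|/eqP nz] := pselect (f = 0); first by exists 0%N; left.
have [w fw] : exists w, f w != 0.
  apply: contrapT => no; move/eqP: nz; case; apply/funext => w.
  by apply/eqP/negPn/negP => fw; apply: no; exists w.
by have [v [_ fv vf]] := ps_orderP fw; exists v; right.
Qed.

(** If g_i is nonzero of order o_i, its power has order B^i o_i with 0 < o_i < B.
    These orders are pairwise distinct, so no cancellation occurs. *)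
Lemma ps_sum_powers_neq0 n (g : 'I_n -> pseries K) (o : 'I_n -> nat) B :
  (forall i, g i 0%N = 0) ->
  (forall i, g i = 0 \/ ps_vanish (o i) (g i) /\ g i (o i) != 0) ->
  (forall i, (o i < B)%N) -> (exists i, g i <> 0) ->
  exists w, (\sum_(i < n) g i ^+ (B ^ i)) w != 0.
Proof.
move=> g0 go oB [i1 /eqP nz1].
case: (@arg_minnP _ i1 (fun i => g i != 0) (fun i => val i)) => // i0 nz0 min.
have [/eqP e0|[v0 l0]] := go i0; first by rewrite e0 in nz0.
(* g_i0 is the first nonzero series; the later powers have larger order. *)
exists (B ^ i0 * o i0)%N; rewrite ps_sumE (bigD1 i0) //= big1 => [|i ne].
  by rewrite addr0 ps_lead_coefX // expf_neq0.
have [gi0|[vi li]] := go i.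
  rewrite gi0 expr0n -[LHS]/(((_ == _)%:R : pseries K) _).
  have : (0 < B ^ i)%N by rewrite expn_gt0; have := oB i; lia.
  by case: (B ^ i)%N.
have oi : (0 < o i)%N.
  by rewrite lt0n; apply: contraNneq li => ->; rewrite g0.
have gi : g i != 0 by apply: contraNneq li => ->.
have lt : (i0 < i)%N by rewrite ltn_neqAle min // andbT eq_sym.
rewrite -[LHS]/((g i ^+ (B ^ i)) (B ^ i0 * o i0)%N).
rewrite (ps_vanishX (e := (B ^ i)%N) vi) //.
have B0 : (0 < B)%N by have := oB i; lia.
have BX : (0 < B ^ i0)%N by rewrite expn_gt0 B0.
have := leq_pexp2l B0 lt; rewrite expnS; have := oB i0; nia.
Qed.

End OrderField.

(** One polynomial expression in the coordinates that vanishes on no branch. A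
    general linear combination would do over an infinite field; sums of powers
    work over every field, and their coefficients, being 0 and 1, make sense in
    every ring of the family. *)
Lemma exists_uniform_powers (K : fieldType) n r (g : 'I_r -> 'I_n -> pseries K) :
  (forall j i, g j i 0%N = 0) -> (forall j, exists i, g j i <> 0) ->
  exists (B : nat) (w : 'I_r -> nat), (0 < B)%N /\
    forall j, (\sum_(i < n) g j i ^+ (B ^ i)) (w j) != 0.
Proof.
move=> g0 gnz.
pose o j i := projT1 (cid (exists_order (g j i))).
have oP j i : g j i = 0 \/ ps_vanish (o j i) (g j i) /\ g j i (o j i) != 0.
  exact: projT2 (cid (exists_order (g j i))).
pose B := (\sum_j \sum_i o j i).+1.
have oB j i : (o j i < B)%N.
  by rewrite ltnS (bigD1 j) //= (bigD1 i) //= -addnA leq_addr.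
have [j|w wP] := @choice _ _ (fun j w => (\sum_(i < n) g j i ^+ (B ^ i)) w != 0).
  exact: ps_sum_powers_neq0 (g0 j) (oP j) (oB j) (gnz j).
by exists B, w.
Qed.

(** * Ranks and minors *)

(** Counts vectors that are independent modulo the row space of [X]: with
    [X] encoding the image of a parameterization, it converts dimensions of
    quotients into ranks. *)
Lemma rank_adds_free (F : fieldType) m N n (X : 'M[F]_(m, n)) (Y : 'M[F]_(N, n)) :
  (forall c : 'rV_N, (c *m Y <= X)%MS -> c = 0) ->
  \rank (X + Y)%MS = (\rank X + N)%N.
Proof.
move=> free; have /eqP rY : row_free Y.
  rewrite -kermx_eq0; apply/rowV0P => c /sub_kermxP e.
  by apply: free; rewrite e sub0mx.
rewrite -[X in (_ + X)%N]rY -mxrank_sum_cap.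
suff /eqP-> : (X :&: Y)%MS == 0 by rewrite mxrank0 addn0.
apply/rowV0P => v; rewrite sub_capmx => /andP[vX /submxP[c ev]].
by rewrite ev (free c) ?mul0mx // -ev.
Qed.

Lemma exists_nonzero_minor (F : fieldType) m n (X : 'M[F]_(m, n)) :
  exists (f : 'I_(\rank X) -> 'I_m) (g : 'I_(\rank X) -> 'I_n),
    \det (mxsub f g X) != 0.
Proof.
pose f := maxrankfun X.
have full : row_full (rowsub f X)^T by rewrite /row_full mxrank_tr; apply: maxrowsub_free.
exists f, (fullrankfun full); have := fullrowsub_unit full.
rewrite unitmxE unitfE -det_tr; congr (\det _ != 0).
by apply/matrixP => i j; rewrite !mxE.
Qed.

Lemma rank_ge_minor (F : fieldType) m n k (X : 'M[F]_(m, n))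
    (f : 'I_k -> 'I_m) (g : 'I_k -> 'I_n) :
  \det (mxsub f g X) != 0 -> (k <= \rank X)%N.
Proof.
rewrite -unitfE -unitmxE -row_free_unit => /eqP<-.
have -> : mxsub f g X = (rowsub g (rowsub f X)^T)^T.
  by apply/matrixP => i j; rewrite !mxE.
rewrite mxrank_tr; apply: leq_trans (mxrankS (rowsub_sub _ _)) _.
by rewrite mxrank_tr mxrankS // rowsub_sub.
Qed.

(** * Truncation of multi-branch series *)

Section BranchMorphism.
Variables (r : nat) (A : comNzRingType) (j : 'I_r).

Fact branch_zmod_morphism : zmod_morphism (@branch r A j).
Proof. by move=> y z; rewrite /branch !ffunE. Qed.

Fact branch_monoid_morphism : monoid_morphism (@branch r A j).
Proof. by split=> [|y z]; rewrite /branch !ffunE. Qed.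

Fact branch_scalable : scalable (@branch r A j).
Proof. by move=> c y; rewrite /branch !ffunE. Qed.

HB.instance Definition _ := GRing.isZmodMorphism.Build
  (branches r A) (pseries A) (@branch r A j) branch_zmod_morphism.
HB.instance Definition _ := GRing.isMonoidMorphism.Build
  (branches r A) (pseries A) (@branch r A j) branch_monoid_morphism.
HB.instance Definition _ := GRing.isScalable.Build
  A (branches r A) (pseries A) *:%R (@branch r A j) branch_scalable.

Lemma branchM (y z : branches r A) : branch j (y * z) = branch j y * branch j z.
Proof. exact: (rmorphM (@branch r A j)). Qed.

Lemma branchX (y : branches r A) e : branch j (y ^+ e) = branch j y ^+ e.
Proof. exact: (rmorphXn (@branch r A j)). Qed.

End BranchMorphism.

Lemma branchP r A (y z : branches r A) :
  (forall j, branch j y = branch j z) -> y = z.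
Proof. by move=> e; apply/ffunP. Qed.

Lemma br_scalerAr r (A : comNzRingType) (c : A) (y z : branches r A) :
  c *: (y * z) = y * (c *: z).
Proof.
by apply: branchP => j; rewrite branchM !linearZ /= branchM scalerAr.
Qed.

(** Membership in the power of exponent [d] of the ideal of the variables. *)
Definition mps_vanish n (A : comNzRingType) (d : nat) (f : mpseries n A) : Prop :=
  forall a, (mdeg a < d)%N -> f a = 0.

Lemma mps_vanishM n (A : comNzRingType) c d (f h : mpseries n A) :
  mps_vanish c f -> mps_vanish d h -> mps_vanish (c + d) (f * h).
Proof.
move=> vf vh a acd; rewrite mps_coefM big1 // => k /eqP ek.
have [kc|ck] := ltnP (mdeg k.1) c; first by rewrite vf ?mul0r.
rewrite vh ?mulr0 //; have := congr1 (@mdeg n) ek; rewrite mdegD; move: acd ck.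
by set x := mdeg k.1; set y := mdeg k.2; set z := mdeg a; lia.
Qed.

Lemma mps_vanishX n (A : comNzRingType) e (f : mpseries n A) :
  f 0%MM = 0 -> mps_vanish e (f ^+ e).
Proof.
move=> f0; have v1 : mps_vanish 1 f.
  by move=> a; rewrite ltnS leqn0 mdeg_eq0 => /eqP->.
elim: e => [|e IH] //; rewrite exprS -add1n; exact: mps_vanishM.
Qed.

Lemma mps_sumE n (A : comNzRingType) I (s : seq I) P (F : I -> mpseries n A) a :
  (\sum_(i <- s | P i) F i) a = \sum_(i <- s | P i) F i a.
Proof. by elim/big_rec2: _ => // i x y _ <-. Qed.

Definition br_vanish r (A : comNzRingType) (d : nat) (y : branches r A) : Prop :=
  forall j, ps_vanish d (branch j y).

Lemma br_vanish_eq0 r (A : comNzRingType) (y : branches r A) :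
  (forall d, br_vanish d y) -> y = 0.
Proof.
by move=> vy; apply: branchP => j; rewrite raddf0; apply: ps_vanish_eq0 => d; apply: vy.
Qed.

Definition truncate r (A : comNzRingType) (M : nat) (y : branches r A) : 'rV[A]_(r * M) :=
  mxvec (\matrix_(j < r, m < M) branch j y m).

Definition untruncate r (A : comNzRingType) (M : nat) (v : 'rV[A]_(r * M)) : branches r A :=
  [ffun j => fun m => if insub m is Some i then vec_mx v j i else 0].

(** The monomial x^a, given by its coefficients instead of as a product of
    variables, so that truncations are visibly linear combinations of these. *)
Definition mps_monom n (A : comNzRingType) (a : 'X_{1..n}) : mpseries n A :=
  fun b => (b == a)%:R.

Section Truncate.
Variables (r M : nat) (A : comNzRingType).
Implicit Types y z : branches r A.

Fact truncate_linear : linear (@truncate r A M).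
Proof.
move=> c y z; rewrite /truncate -linearP; congr mxvec.
by apply/matrixP => j m; rewrite !mxE linearP.
Qed.
HB.instance Definition _ := GRing.isLinear.Build A (branches r A) 'rV[A]_(r * M) *:%R
  (@truncate r A M) truncate_linear.

Lemma untruncateK : cancel (@untruncate r A M) (@truncate r A M).
Proof.
move=> v; rewrite -[RHS]vec_mxK; congr mxvec; apply/matrixP => j m.
by rewrite mxE /branch ffunE insubT // => lt; congr (vec_mx v j _); apply: val_inj.
Qed.

Lemma truncate_eq0 y : truncate M y = 0 <-> br_vanish M y.
Proof.
split=> [e j m mM|vy].
  have := congr1 vec_mx e; rewrite mxvecK raddf0 => /matrixP/(_ j (Ordinal mM)).
  by rewrite !mxE.
rewrite /truncate -(raddf0 mxvec); congr mxvec; apply/matrixP => j m.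
by rewrite !mxE vy.
Qed.

End Truncate.

(** * Conductor and codimension of the image of a parameterization *)

Section Germ.
Variables (n r : nat) (K : fieldType).
Variable psi : {lrmorphism mpseries n K -> branches r K}.
Hypothesis psi_cont : forall d f, mps_vanish d f -> br_vanish d (psi f).

(** Completeness of k[[x]] replaces Nakayama's lemma: iterating the hypothesis
    writes psi(u)^i y as a sum of terms psi(u^l f_l), and the sum of the u^l f_l
    converges because [u] lies in the maximal ideal. *)
Lemma image_of_stationary (u : mpseries n K) i : u 0%MM = 0 ->
  (forall y, exists f y', psi u ^+ i * y = psi f + psi u ^+ i.+1 * y') ->
  forall y, exists f, psi f = psi u ^+ i * y.
Proof.
move=> u0 step y0.
have [F FP] := choice step; have {step} [G FG] := choice FP.
set fseq := fun l => F (iter l G y0).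
(* The remainder of each step is fed into the next one. *)
have sumE L : psi u ^+ i * y0 = psi (\sum_(l < L) u ^+ l * fseq l)
    + psi u ^+ (i + L) * iter L G y0.
  elim: L => [|L IH]; first by rewrite big_ord0 raddf0 add0r addn0.
  rewrite IH big_ord_recr /= [in RHS]raddfD /= -addrA; congr (_ + _).
  rewrite exprD mulrC mulrA -[_ * psi u ^+ i]mulrC FG /fseq.
  rewrite rmorphM rmorphXn /= addnS !exprS !exprD; ring.
(* u^l f_l has order at least l, so a coefficient of the infinite sum only sees
   the terms with l at most the degree of its monomial. *)
pose f : mpseries n K := fun a => \sum_(l < (mdeg a).+1) (u ^+ l * fseq l) a.
have vX l h : mps_vanish l (u ^+ l * h).
  by rewrite -[l in mps_vanish l]addn0; apply: mps_vanishM => //; apply: mps_vanishX.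
have vf L : mps_vanish L (f - \sum_(l < L) u ^+ l * fseq l).
  move=> a aL; apply/eqP.
  rewrite -[X in X == _]/(f a - (\sum_(l < L) u ^+ l * fseq l) a) subr_eq0 mps_sumE.
  rewrite /f -(subnKC aL) big_split_ord /= [X in _ == _ + X]big1 ?addr0 // => l _.
  by rewrite vX //=; lia.
exists f; apply/eqP; rewrite -subr_eq0; apply/eqP/br_vanish_eq0 => L.
rewrite (sumE L) opprD addrA -raddfB => j; rewrite (raddfB (@branch r K j)).
apply: ps_vanishD; first exact: psi_cont.
apply: ps_vanishN.
rewrite /= branchM branchX mulrC; apply: ps_vanishMl.
rewrite -[L in ps_vanish L]muln1; apply: ps_vanish_le (leq_mul (leq_addl i L) (leqnn 1)) _.
apply: ps_vanishX; apply: psi_cont.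
by move=> a; rewrite ltnS leqn0 mdeg_eq0 => /eqP->.
Qed.

(** By continuity, the images of the finitely many monomials of degree less than
    [M] span the image of psi modulo t^M; the codimension of the image modulo
    t^M is read off from the rank of this matrix. *)
Definition monomial_mx (M : nat) : 'M[K]_(#|{: 'X_{1..n < M}}|, r * M) :=
  \matrix_i truncate M (psi (mps_monom K (enum_val i : 'X_{1..n < M}))).

(** By continuity, psi f modulo t^M only depends on the terms of f of degree less
    than [M]. *)
Lemma truncate_image M y :
  (truncate M y <= monomial_mx M)%MS <-> exists f, truncate M y = truncate M (psi f).
Proof.
have trE f : truncate M (psi f) =
    (\row_i f (enum_val i : 'X_{1..n < M})) *m monomial_mx M.
  rewrite mulmx_sum_row (eq_bigr (fun i => truncate M
      (psi (f (enum_val i : 'X_{1..n < M}) *: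
            mps_monom K (enum_val i : 'X_{1..n < M}))))); last first.
    by move=> i _; rewrite mxE rowK !linearZ.
  rewrite -!raddf_sum /=; apply/eqP; rewrite -subr_eq0 -!raddfB; apply/eqP.
  apply/truncate_eq0/psi_cont => a aM.
  rewrite -[LHS]/(f a - _ a) mps_sumE.
  rewrite (bigD1 (enum_rank (BMultinom aM))) //= big1 => [|i ne].
    by rewrite enum_rankK mps_coefZ /= /mps_monom eqxx mulr1 addr0 subrr.
  rewrite mps_coefZ /mps_monom; case: eqP => [e|]; last by rewrite mulr0.
  case/eqP: ne; rewrite -[i]enum_valK; congr enum_rank; exact: val_inj.
split=> [/submxP[D e]|[f ->]]; last by rewrite trE submxMl.
pose f : mpseries n K := fun a =>
  if insub a is Some b then D 0 (enum_rank (b : 'X_{1..n < M})) else 0.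
exists f; rewrite e trE; congr (_ *m _); apply/rowP => i; rewrite !mxE.
rewrite /f insubT ?bmdeg // => lt; rewrite -[in LHS](enum_valK i).
by congr (D 0 (enum_rank _)); apply: val_inj.
Qed.

Let image y := exists f, psi f = y.

(** In the chain of the R + u^i S, for i = 0, ..., N, with R the image of psi
    and S the product of the k[[t_j]], a strict inclusion at each step would
    give [N] vectors u^i y_i independent modulo R + u^N S, hence modulo R + t^M S.
    The rank hypothesis says that the codimension of R + t^M S is less than
    [N]. *)
Lemma chain_stationary (u : mpseries n K) N M :
  (forall y, br_vanish M y -> exists z, y = psi u ^+ N * z) ->
  (r * M < \rank (monomial_mx M) + N)%N ->
  exists2 i, (i <= N)%N & forall y, exists f y',
    psi u ^+ i * y = psi f + psi u ^+ i.+1 * y'.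
Proof.
move=> fact; apply: contraPP => noi; apply/negP; rewrite -leqNgt.
have ex (i : 'I_N) : exists y, forall f y',
    psi u ^+ i * y <> psi f + psi u ^+ i.+1 * y'.
  apply: contrapT => noy; apply: noi; exists i; first exact: ltnW.
  move=> y; apply: contrapT => nof; apply: noy; exists y => f y' e.
  by apply: nof; exists f, y'.
have [Y YP] := choice ex; pose Z := \matrix_(i < N) truncate M (psi u ^+ i * Y i).
rewrite -(@rank_adds_free _ _ _ _ _ Z) ?rank_leq_col // => c.
have -> : c *m Z = truncate M (\sum_i c 0 i *: (psi u ^+ i * Y i)).
  rewrite mulmx_sum_row raddf_sum; apply: eq_bigr => i _.
  by rewrite rowK -linearZ.
move=> /truncate_image[f /eqP].
rewrite -subr_eq0 -raddfB => /eqP/truncate_eq0/fact[z /eqP].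
rewrite subr_eq => /eqP e; apply: contrapT => /eqP c0.
have [i1 ci1] : exists i, c 0 i != 0.
  apply: contrapT => no; case/eqP: c0; apply/rowP => i; rewrite mxE.
  by apply/eqP/negPn/negP => ci; apply: no; exists i.
(* Solving the relation for its first term contradicts the choice of Y i0. *)
case: (@arg_minnP _ i1 (fun i => c 0 i != 0) (fun i => val i)) => // i0 nz min.
apply: (YP i0 ((c 0 i0)^-1 *: f)
   ((c 0 i0)^-1 *: (psi u ^+ (N - i0.+1) * z -
     \sum_(i | i != i0) c 0 i *: (psi u ^+ (i - i0.+1) * Y i)))).
rewrite linearZ -br_scalerAr -[LHS](scalerK nz) -scalerDr; congr (_ *: _).
have -> : psi u ^+ i0.+1 * (psi u ^+ (N - i0.+1) * z -
     \sum_(i | i != i0) c 0 i *: (psi u ^+ (i - i0.+1) * Y i)) =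
   psi u ^+ N * z - \sum_(i | i != i0) c 0 i *: (psi u ^+ i * Y i).
  rewrite mulrBr mulrA -exprD subnKC //; congr (_ - _).
  rewrite big_distrr; apply: eq_bigr => i ne /=.
  have [->|ci] := eqVneq (c 0 i) 0; first by rewrite !scale0r mulr0.
  have lt : (i0 < i)%N by rewrite ltn_neqAle min // andbT eq_sym.
  by rewrite -br_scalerAr mulrA -exprD subnKC.
by rewrite addrA [psi f + _]addrC -e (bigD1 i0) //= addrK.
Qed.

(** A bound for the conductor that depends only on the order of one element [u]
    on the branches and on the codimension modulo one fixed power of t. Both are
    inherited by neighbouring points, so the bound is uniform near a point
    of a family. *)
Lemma conductor_of_rank (u : mpseries n K) N w :
  u 0%MM = 0 -> (forall j, exists2 v, (v <= w)%N & branch j (psi u) v != 0) ->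
  (r * (N * w) < \rank (monomial_mx (N * w)) + N)%N ->
  forall y, br_vanish (N * w) y -> image y.
Proof.
move=> u0 uw lt.
have fact y : br_vanish (N * w) y -> exists z, y = psi u ^+ N * z.
  move=> vy.
  have ex j : exists z, branch j y = branch j (psi u) ^+ N * z.
    have [v vw nz] := uw j; have [v' [v'v nz' van]] := ps_orderP nz.
    apply: (@ps_divides _ (N * v')); first by rewrite ps_lead_coefX ?expf_neq0.
    by apply: ps_vanish_le (vy j); rewrite leq_mul // (leq_trans v'v).
  have [z zP] := choice ex; exists [ffun j => z j]; apply: branchP => j.
  by rewrite branchM branchX zP [in RHS]/branch ffunE.
have [i iN step] := chain_stationary fact lt.
move=> y /fact[z ->]; rewrite -(subnKC iN) exprD -mulrA.
exact: image_of_stationary u0 step _.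
Qed.

(** The image and the [d] basis vectors still span after truncation, where the
    vectors may become dependent: hence only an inequality. *)
Lemma rank_ge_of_basis_mod d (v : 'I_d -> branches r K) M :
  basis_mod *:%R (fun=> True) image v ->
  (r * M <= \rank (monomial_mx M) + d)%N.
Proof.
move=> [_ span]; pose V := \matrix_i truncate M (v i).
suff full : (1%:M <= monomial_mx M + V)%MS.
  have := mxrankS full; rewrite mxrank1 => le; apply: leq_trans le _.
  apply: leq_trans (mxrank_adds_leqif _ _) _.
  by rewrite leq_add2l rank_leq_row.
apply/row_subP => i; rewrite -[row i _]untruncateK; set y := untruncate _.
have [c [[f e] _]] := span y I.
rewrite -[y](subrK (\sum_i c i *: v i)) -e raddfD addmx_sub_adds //.
  by apply/truncate_image => //; exists f.
rewrite raddf_sum summx_sub // => l _; rewrite /= linearZ scalemx_sub //.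
by have := row_sub l V; rewrite rowK.
Qed.

Section Codim.
Variable c : nat.
Hypothesis cond : forall y, br_vanish c y -> image y.
Let X := monomial_mx c.

(** If y agrees with psi f modulo t^c, the difference is itself in the image. *)
Lemma image_truncate y : image y <-> (truncate c y <= X)%MS.
Proof.
split=> [[f <-]|/truncate_image[f /eqP]].
  by apply/truncate_image => //; exists f.
rewrite -subr_eq0 -raddfB => /eqP/truncate_eq0/cond[h e].
by exists (h + f); rewrite raddfD /= e subrK.
Qed.

Lemma truncate_comb d (v : 'I_d -> branches r K) (a : 'I_d -> K) :
  truncate c (\sum_i a i *: v i) =
  (\row_i a i) *m (\matrix_i truncate c (v i)).
Proof.
rewrite mulmx_sum_row raddf_sum; apply: eq_bigr => i _.
by rewrite mxE rowK -linearZ.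
Qed.

Lemma basis_mod_size d (v : 'I_d -> branches r K) :
  basis_mod *:%R (fun=> True) image v -> (\rank X + d = r * c)%N.
Proof.
move=> bv; apply/eqP; rewrite eqn_leq (rank_ge_of_basis_mod c bv) andbT.
case: bv => _ span.
rewrite -(@rank_adds_free _ _ _ _ _ (\matrix_i truncate c (v i))) ?rank_leq_col // => a aX.
have [b [_ uniq]] := span 0 I.
have im0 : image (0 - \sum_i (fun=> 0) i *: v i).
  by exists 0; rewrite big1 ?subr0 ?raddf0 // => i _; rewrite scale0r.
have ima : image (0 - \sum_i (fun i => a 0 i) i *: v i).
  apply/image_truncate; rewrite raddfB raddf0 sub0r /= truncate_comb eqmx_opp.
  by congr (_ *m _ <= _)%MS: aX; apply/rowP => i; rewrite mxE.
apply/rowP => i; rewrite mxE; transitivity (b i); last by rewrite (uniq _ im0).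
by rewrite (uniq _ ima).
Qed.

Lemma basis_mod_exists :
  exists d (v : 'I_d -> branches r K), basis_mod *:%R (fun=> True) image v.
Proof.
pose B := row_base (X^C)%MS; exists (\rank (X^C)%MS), (fun i => untruncate (row i B)).
have VB : \matrix_i truncate c (untruncate (row i B)) = B.
  by apply/row_matrixP => i; rewrite rowK untruncateK.
split=> // y _.
have : (truncate c y <= X + X^C)%MS by rewrite submx_full ?addsmx_compl_full.
case/sub_addsmxP => -[a1 a2] /= ey.
have /submxP[b eb] : (a2 *m X^C <= B)%MS by rewrite eq_row_base submxMl.
exists (fun i => b 0 i); split=> [|b' /image_truncate].
  apply/image_truncate; rewrite raddfB /= truncate_comb VB ey eb.
  have -> : \row_i b 0 i = b by apply/rowP => i; rewrite mxE.
  by rewrite addrK submxMl.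
rewrite raddfB /= truncate_comb VB ey eb -addrA -mulmxBl => sX.
have {}sX : ((b - \row_i b' i) *m B <= X)%MS.
  by rewrite -[X in (X <= _)%MS](addKr (a1 *m X)) addmx_sub // eqmx_opp submxMl.
have : ((b - \row_i b' i) *m B <= X :&: X^C)%MS.
  by rewrite sub_capmx sX (submx_trans (submxMl _ _)) // eq_row_base.
rewrite capmx_compl submx0 => /eqP; rewrite -[RHS](mul0mx _ B) => /row_free_inj.
rewrite row_base_free => /(_ isT)/eqP; rewrite subr_eq0 => /eqP-> //.
by apply/funext => i; rewrite mxE.
Qed.

End Codim.
End Germ.

(** * Normalization *)

Section TotalQuotient.
Variable R : comPzRingType.
Implicit Types (z : total_quotient R) (a s : R).

Lemma total_quotient_mulI s z z' : s \in @nonzerodivisor R ->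
  to_total_quotient s * z = to_total_quotient s * z' -> z = z'.
Proof.
move=> Ss; have inv : (loc_frac 1 Ss : total_quotient R) * to_total_quotient s = 1.
  rewrite /to_total_quotient /loc_inj loc_fracM; apply/loc_frac_eq.
  by exists 1; rewrite ?rpred1 // !mul1r.
by move=> e; rewrite -[z]mul1r -inv -mulrA e mulrA inv mul1r.
Qed.

Lemma to_total_quotient_inj : injective (@to_total_quotient R).
Proof.
move=> a b /loc_frac_eq[u /asboolP nzd e]; apply/eqP; rewrite -subr_eq0.
by apply/eqP/nzd; move: e; rewrite !mulr1 mulrBr => ->; rewrite subrr.
Qed.

Lemma total_quotientM_frac a s (Ss : s \in @nonzerodivisor R) :
  to_total_quotient s * (loc_frac a Ss : total_quotient R) = to_total_quotient a.
Proof.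
rewrite /to_total_quotient /loc_inj loc_fracM; apply/loc_frac_eq.
by exists 1; rewrite ?rpred1 //; ring.
Qed.

Lemma total_quotientP z :
  exists a s, s \in @nonzerodivisor R /\ to_total_quotient s * z = to_total_quotient a.
Proof.
have [a [s [Ss ->]]] := loc_fracP z.
by exists a, s; split; last exact: total_quotientM_frac.
Qed.

End TotalQuotient.

Section Normalization.
Variables (r : nat) (K : fieldType) (R : comPzRingType).
Variable f : {rmorphism R -> branches r K}.

Section Conductor.
Variable c : nat.
Hypothesis scal : forall a : K, exists x, f x = a *: (1 : branches r K).
Hypothesis cond : forall y, br_vanish c.+1 y -> exists x, f x = y.

(** With a_j the constant term of y_j, the element X prod_j (X - a_j) evaluated at y has
    order at least 1 on every branch, so its power of exponent c + 1 lies in R. *)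
Lemma branches_integral (y : branches r K) : integral_over f y.
Proof.
(* The factor X keeps the degree of Q positive when r = 0. *)
pose Q := ('X * \prod_(j < r) ('X - (branch j y 0%N)%:P)) ^+ c.+1.
have monQ : Q \is monic.
  by rewrite monic_exp // monicMr ?monicX // monic_prod_XsubC.
have sQ : (1 < size Q)%N.
  pose P := \prod_(j < r) ('X - (branch j y 0%N)%:P); have nz : P != 0.
    by rewrite monic_neq0 // monic_prod_XsubC.
  have := size_exp ('X * P) c.+1; rewrite -/Q size_mul ?polyX_eq0 // size_polyX.
  move: nz; rewrite -size_poly_gt0 !add2n /=.
  by case: (size P) => // k _; case: (size Q) => [|[|q]] //=; rewrite mulSn.
have van j : ps_vanish c.+1 (horner_alg (branch j y) Q).
  rewrite rmorphXn -[X in ps_vanish X]muln1; apply: ps_vanishX.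
  rewrite rmorphM; apply: ps_vanishMl; rewrite rmorph_prod (bigD1 j) //= mulrC.
  apply: ps_vanishMl; rewrite rmorphB /= horner_algX horner_algC.
  move=> m; rewrite ltnS leqn0 => /eqP->.
  rewrite -[LHS]/(branch j y 0%N - branch j y 0%N * (1 : pseries K) 0%N).
  by rewrite ps_coef1 mulr1 subrr.
have [z ez] : exists z, f z = [ffun j => horner_alg (branch j y) Q].
  by apply: cond => j; rewrite /branch ffunE; apply: van.
have [kap kapP] := choice scal.
pose d := (size Q).-1; have d0 : (0 < d)%N by rewrite /d; lia.
exists d, (fun i : 'I_d => kap Q`_i - (if i == Ordinal d0 then z else 0)).
apply: branchP => j; rewrite raddf0 raddfD /= branchX raddf_sum /=.
transitivity (branch j y ^+ d + \sum_(i < d) Q`_i *: branch j y ^+ i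
   - horner_alg (branch j y) Q).
  rewrite -addrA; congr (_ + _).
  under eq_bigr => i _ do rewrite branchM branchX !rmorphB /= kapP linearZ rmorph1 mulrBl mulr_algl.
  rewrite sumrB; congr (_ - _); rewrite (bigD1 (Ordinal d0)) //= ?eqxx expr0 mulr1.
  rewrite ez /branch ffunE big1 ?addr0 // => i /negbTE->.
  by rewrite !rmorph0 ffunE mul0r.
apply/eqP; rewrite subr_eq0; apply/eqP.
rewrite -[in RHS](coefK Q) poly_def raddf_sum -(prednK (ltnW sQ)) big_ord_recr /=.
rewrite addrC -lead_coefE (monicP monQ) scale1r [horner_alg _ _]rmorphXn /=.
rewrite horner_algX; congr (_ + _).
by apply: eq_bigr => i _; rewrite linearZ rmorphXn /= horner_algX mulr_algl.
Qed.

Hypothesis finj : injective f.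

Lemma nonzerodivisor_branch s : s \in @nonzerodivisor R ->
  forall j, exists w, branch j (f s) w != 0.
Proof.
move=> /asboolP nzd j; apply: contrapT => no.
have sj : branch j (f s) = 0.
  apply/funext => w; apply/eqP/negPn/negP => nz; by apply: no; exists w.
(* Otherwise s kills t^(c+1) on the branch j, which lies in R. *)
pose E : branches r K := [ffun l => if l == j then ps_monom K c.+1 else 0].
have [x ex] : exists x, f x = E.
  apply: cond => l; rewrite /branch ffunE; case: eqP => _ //.
  exact: ps_vanish_monom.
have x0 : x = 0.
  apply: nzd; apply: finj; rewrite rmorphM rmorph0 ex; apply: branchP => l.
  rewrite branchM raddf0 /= {2}/branch ffunE; case: eqP => [->|_].
    by rewrite sj mul0r.
  by rewrite mulr0.
have := congr1 (fun y => branch j y c.+1) ex; rewrite x0 rmorph0 /branch !ffunE eqxx.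
by rewrite /ps_monom eqxx => /esym/eqP; rewrite oner_eq0.
Qed.

(** The element T = t^(c+1) on all branches is a nonzerodivisor of R that carries
    the product S of the k[[t_j]] into R, so S embeds in the total quotient ring as
    the fractions (T y) / T. It consists of integral elements, and it contains
    all of them because each k[[t_j]] is integrally closed. *)
Lemma normalization_of_conductor : is_normalization f.
Proof.
pose T : branches r K := [ffun=> ps_monom K c.+1].
have TM y : T * y = 0 -> y = 0.
  move=> Ty; apply: branchP => j; rewrite raddf0; apply: (@ps_monomM_eq0 _ c.+1).
  by have := congr1 (branch j) Ty; rewrite branchM raddf0 {1}/branch ffunE.
have ex y : exists x, f x = T * y.
  apply: cond => j; rewrite branchM {1}/branch ffunE mulrC.
  exact: ps_vanishMl (@ps_vanish_monom _ _).
have [h hP] := choice ex.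
have [s es] : exists s, f s = T by have [s es] := ex 1; exists s; rewrite es mulr1.
have Ss : s \in @nonzerodivisor R.
  apply/asboolP => x e; apply: finj; rewrite rmorph0; apply: TM.
  by rewrite -es -rmorphM e rmorph0.
(* y = (T y) / T, where both T y and T come from R. *)
pose g (y : branches r K) : total_quotient R := loc_frac (h y) Ss.
have gs y : to_total_quotient s * g y = to_total_quotient (h y).
  exact: total_quotientM_frac.
have gz : zmod_morphism g.
  move=> y z; apply: (total_quotient_mulI Ss); rewrite mulrBr !gs -rmorphB.
  by congr to_total_quotient; apply: finj; rewrite rmorphB !hP mulrBr.
have gm : monoid_morphism g.
  split=> [|y z].
    apply: (total_quotient_mulI Ss); rewrite mulr1 gs.
    by congr to_total_quotient; apply: finj; rewrite hP mulr1 es.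
  apply: (total_quotient_mulI Ss); apply: (total_quotient_mulI Ss).
  transitivity (to_total_quotient s * g y * (to_total_quotient s * g z)); last first.
    by rewrite [LHS]mulrACA -[LHS]mulrA.
  rewrite !gs -!rmorphM.
  by congr to_total_quotient; apply: finj; rewrite !rmorphM !hP es; ring.
pose gM : {rmorphism branches r K -> total_quotient R} := HB.pack g
  (GRing.isZmodMorphism.Build _ _ g gz) (GRing.isMonoidMorphism.Build _ _ g gm).
have gf x : g (f x) = to_total_quotient x.
  apply: (total_quotient_mulI Ss); rewrite gs -rmorphM.
  by congr to_total_quotient; apply: finj; rewrite hP rmorphM es.
exists gM; split=> // [y z|z].
  move=> /(congr1 (fun w => to_total_quotient s * w)); rewrite /= !gs.
  move=> /to_total_quotient_inj/(congr1 f); rewrite !hP => /eqP.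
  by rewrite -subr_eq0 -mulrBr => /eqP/TM/eqP; rewrite subr_eq0 => /eqP.
split=> [[d [b e]]|[y <-]]; last first.
  have [d [b e]] := branches_integral y; exists d, b.
  transitivity (gM (y ^+ d + \sum_(i < d) f (b i) * y ^+ i)); last by rewrite e rmorph0.
  rewrite rmorphD rmorphXn rmorph_sum; congr (_ + _); apply: eq_bigr => i _.
  by rewrite rmorphM rmorphXn /= gf.
(* Conversely clear denominators in z = a / t: then t divides a on each branch. *)
have [a [t [St ea]]] := total_quotientP z.
have {}e : a ^+ d + \sum_(i < d) b i * (t ^+ (d - i) * a ^+ i) = 0.
  apply: to_total_quotient_inj; rewrite rmorph0 -(mulr0 (to_total_quotient t ^+ d)) -e.
  rewrite mulrDr -exprMn ea rmorphD rmorphXn; congr (_ + _).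
  rewrite rmorph_sum big_distrr; apply: eq_bigr => i _ /=.
  rewrite !rmorphM !rmorphXn /= -ea exprMn [RHS]mulrCA; congr (_ * _).
  by rewrite mulrA -exprD subnK // ltnW.
have ex' j : exists y, branch j (f a) = branch j (f t) * y.
  have [w /ps_orderP[v [_ nz van]]] := nonzerodivisor_branch St j.
  apply: ps_divides nz _.
  apply: (@ps_integral_order _ v d (branch j (f t)) _ (fun i => branch j (f (b i)))) => //.
  have := congr1 (branch j \o f) e; rewrite /= !raddf0 => {}e; rewrite -[RHS]e.
  rewrite !raddfD /= rmorphXn /= branchX !raddf_sum /=; congr (_ + _).
  by apply: eq_bigr => i _; rewrite !rmorphM !rmorphXn /= ?branchM ?branchX.
have [y yP] := choice ex'.
exists [ffun j => y j]; apply: (total_quotient_mulI St).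
rewrite ea -gf -[LHS](rmorphM gM) -(gf a); congr (g _).
by apply: branchP => j; rewrite branchM yP {2}/branch ffunE.
Qed.

End Conductor.

(** Transports bases along the isomorphism of the product of the k[[t_j]] with the
    integral closure, so that delta can be computed without fractions. *)
Lemma basis_mod_normalization (sigma : K -> R) d :
  (forall a, f (sigma a) = a *: (1 : branches r K)) -> is_normalization f ->
  (exists v : 'I_d -> _, basis_mod
     (fun a (z : total_quotient R) => to_total_quotient (sigma a) * z)
     (@integral_closure R) (fun z => exists x, to_total_quotient x = z) v) <->
  (exists v : 'I_d -> _, basis_mod *:%R (fun=> True) (fun y => exists x, f x = y) v).
Proof.
move=> fs [g [ginj gf gint]].
have key (a : 'I_d -> K) (v : 'I_d -> branches r K) y :
    (exists x, to_total_quotient x =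
       g y - \sum_i to_total_quotient (sigma (a i)) * g (v i)) <->
    (exists x, f x = y - \sum_i a i *: v i).
  have -> : g y - \sum_i to_total_quotient (sigma (a i)) * g (v i) =
      g (y - \sum_i a i *: v i).
    rewrite rmorphB rmorph_sum; congr (_ - _); apply: eq_bigr => i _.
    rewrite -gf -rmorphM fs; congr (g _).
    by rewrite mulrC -br_scalerAr mulr1.
  by split=> -[x e]; exists x; [apply: ginj; rewrite gf | rewrite -gf e].
split=> [[v [vint span]]|[v [_ span]]].
  have ex i : exists y, g y = v i by apply/gint.
  have [w wP] := choice ex; exists w; split=> // y _.
  have [|a [ea uniq]] := span (g y); first by apply/gint; exists y.
  exists a; split; first by apply/key; under eq_bigr => i _ do rewrite wP.
  move=> a' /key; under eq_bigr => i _ do rewrite wP.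
  exact: uniq.
exists (fun i => g (v i)); split=> [i|z /gint[y <-]]; first by apply/gint; exists (v i).
have [a [ea uniq]] := span y I; exists a; split; first exact/key.
by move=> a' /key; apply: uniq.
Qed.

End Normalization.

(** * Specialization of a family to the residue fields *)

Section Residue.
Variable A : comNzRingType.
Implicit Types (a b : A) (q : Spec A).

Lemma to_residue_eq0 q a : (to_residue q a == 0) = (a \in (q : {pred A})).
Proof.
rewrite /to_residue -(rmorph0 (\pi_({ideal_quot (@local_max A q)}))).
rewrite -Quotient.idealrBE subr0.
by apply/idP/idP; rewrite -(@local_maxP A q a 1 (rpred1 _)).
Qed.

Definition principal_open a q := a \notin (q : {pred A}).

Lemma zariski_open_principal a : zariski_open (principal_open a).
Proof.
exists (eq a) => q; rewrite /principal_open; split=> [/negP aq sub|nsub].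
  exact/aq/sub.
by apply/negP => aq; apply: nsub => _ <-.
Qed.

Lemma principal_openM a b q :
  principal_open (a * b) q <-> principal_open a q /\ principal_open b q.
Proof. by rewrite /principal_open prime_idealrM negb_or; split=> /andP. Qed.

Lemma principal_open_prod (I : finType) (a : I -> A) q :
  principal_open (\prod_i a i) q <-> forall i, principal_open (a i) q.
Proof.
split=> [|H]; last first.
  elim/big_rec: _ => [|i x _ IH]; first by rewrite /principal_open idealr1.
  by apply/principal_openM.
by move=> H i; move: H; rewrite (bigD1 i) //= => /principal_openM[].
Qed.

(** Semicontinuity of the rank: a maximal nonzero minor at p remains nonzero
    wherever its determinant, an element of A, lies outside the prime. *)
Lemma rank_principal_open m n (X : 'M[A]_(m, n)) (p : Spec A) :
  exists2 a, principal_open a p & forall q, principal_open a q ->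
    (\rank (map_mx (to_residue p) X) <= \rank (map_mx (to_residue q) X))%N.
Proof.
have [f [g]] := exists_nonzero_minor (map_mx (to_residue p) X).
rewrite -map_mxsub det_map_mx to_residue_eq0 => nz.
exists (\det (mxsub f g X)) => // q nzq; apply: (rank_ge_minor (f := f) (g := g)).
by rewrite -map_mxsub det_map_mx to_residue_eq0.
Qed.

End Residue.

Section Coefficients.
Variables (A B : comNzRingType) (h : {rmorphism A -> B}).

Definition ps_map (f : pseries A) : pseries B := fun m => h (f m).

Fact ps_map_zmod_morphism : zmod_morphism ps_map.
Proof. by move=> f g; apply/funext => m; apply: rmorphB. Qed.

Fact ps_map_monoid_morphism : monoid_morphism ps_map.
Proof.
split=> [|f g]; apply/funext => m.
  by rewrite /ps_map !ps_coef1 rmorph_nat.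
rewrite /ps_map !ps_coefM rmorph_sum; apply: eq_bigr => i _; exact: rmorphM.
Qed.

HB.instance Definition _ :=
  GRing.isZmodMorphism.Build (pseries A) (pseries B) ps_map ps_map_zmod_morphism.
HB.instance Definition _ :=
  GRing.isMonoidMorphism.Build (pseries A) (pseries B) ps_map ps_map_monoid_morphism.

End Coefficients.

Lemma mps_subst_monom n (B : comNzRingType) (g : 'I_n -> pseries B) (a : 'X_{1..n}) :
  (forall i, g i 0%N = 0) -> mps_subst g (mps_monom B a) = \prod_i g i ^+ a i.
Proof.
move=> g0; apply/funext => m; rewrite (mps_substE (F := 'X_[a]) g0).
  by rewrite mmapX.
by move=> b _; rewrite mcoeffX /mps_monom eq_sym.
Qed.

Lemma sum_powers_const0 n (A : comNzRingType) B : (0 < B)%N ->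
  (\sum_(i < n) mps_var A i ^+ (B ^ i)) 0%MM = 0.
Proof.
move=> B0; rewrite mps_sumE big1 // => i _; apply: (mps_vanishX (e := (B ^ i)%N)).
  by rewrite /mps_var eq_sym mnm1_eq0.
by rewrite mdeg0 expn_gt0 B0.
Qed.

Section Induced.
Variables (A : comNzRingType) (n r : nat) (phi : param_family A n r).

Definition family_var (j : 'I_r) (i : 'I_n) : pseries A := branch j (phi (mps_var A i)).

(** The matrix over A that specializes to [monomial_mx] at every prime. *)
Definition family_monomial_mx (M : nat) : 'M[A]_(#|{: 'X_{1..n < M}}|, r * M) :=
  \matrix_i truncate M ([ffun j => \prod_l family_var j l ^+
     (enum_val i : 'X_{1..n < M}) l] : branches r A).

Variable q : Spec A.
Local Notation k := (residue_field q).
Let psi : {lrmorphism mpseries n k -> branches r k} := @induced A n r phi q.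

Lemma induced_cont d f : mps_vanish d f -> br_vanish d (psi f).
Proof.
move=> vf j m md; rewrite /branch ffunE /mps_subst big1 // => a _.
rewrite vf ?mul0r //; apply: leq_trans md; exact: bmdeg.
Qed.

Lemma induced_monomial_mx M :
  monomial_mx psi M = map_mx (to_residue q) (family_monomial_mx M).
Proof.
apply/row_matrixP => i; rewrite -map_row !rowK /truncate map_mxvec; congr mxvec.
apply/matrixP => j m; rewrite !mxE /branch !ffunE mps_subst_monom; last exact: induced_var0.
rewrite -[RHS]/(ps_map (to_residue q) _ m) rmorph_prod.
by apply: (congr1 (fun F : pseries k => F m)); apply: eq_bigr => l _; rewrite rmorphXn.
Qed.

Lemma induced_sum_powers B j :
  branch j (psi (\sum_i mps_var k i ^+ (B ^ i)))
  = ps_map (to_residue q) (\sum_i family_var j i ^+ (B ^ i)).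
Proof.
rewrite raddf_sum (raddf_sum (@branch r k j)) [RHS]rmorph_sum.
apply: eq_bigr => i _; rewrite /= [in RHS]rmorphXn rmorphXn /= branchX.
congr (_ ^+ _); rewrite /branch ffunE mps_subst_var //; exact: induced_var0.
Qed.

Lemma curve_imageE y :
  (exists x : curve_ring phi q, curve_incl x = y) <-> (exists f, psi f = y).
Proof.
split=> [[x <-]|ex]; first by have /asboolP := valP x.
have Cy : y \in @curve_pred A n r phi q by apply/asboolP.
by exists (Sub y Cy); rewrite /curve_incl SubK.
Qed.

End Induced.

(** * Openness and semicontinuity *)

Lemma dim_mod_Some (k : fieldType) (E : zmodType) (scal : k -> E -> E)
    (V W : E -> Prop) :
  (exists d (v : 'I_d -> E), basis_mod scal V W v) ->
  exists d (v : 'I_d -> E), dim_mod scal V W = Some d /\ basis_mod scal V W v.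
Proof.
rewrite /dim_mod; case: pselect => // h _.
by case: (cid h) => d [v bv]; exists d, v.
Qed.

Lemma dim_mod_neq_None (k : fieldType) (E : zmodType) (scal : k -> E -> E)
    (V W : E -> Prop) :
  dim_mod scal V W <> None -> exists d (v : 'I_d -> E), basis_mod scal V W v.
Proof. by rewrite /dim_mod; case: pselect. Qed.

Section Semicontinuity.
Variables (A : comNzRingType) (n r : nat) (phi : param_family A n r).

Definition contains_conductor (M : nat) (q : Spec A) : Prop :=
  forall y, br_vanish M y -> exists f, induced phi (q := q) f = y.

(** The neighbourhood is given by finitely many elements of A: a nonzero coefficient
    of u on each branch, and a minor of the matrix of monomials modulo t^M that
    keeps the codimension modulo t^M at most its value at [p]. *)
Lemma contains_conductor_near (p : Spec A) :
  is_parameterization (induced phi (q := p)) -> branches_codim phi p <> None ->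
  exists a M, principal_open a p /\ forall q, principal_open a q -> contains_conductor M q.
Proof.
move=> [gnz _] /dim_mod_neq_None[d [v]].
have -> : (fun y => exists x : curve_ring phi p, curve_incl x = y) =
    (fun y => exists f, induced phi (q := p) f = y).
  by apply/funext => y; apply/propext/curve_imageE.
move=> bv.
have [B [w [B0 wP]]] : exists (B : nat) (w : 'I_r -> nat), (0 < B)%N /\
    forall j, (\sum_(i < n) ps_map (to_residue p) (family_var phi j i) ^+ (B ^ i)) (w j) != 0.
  apply: exists_uniform_powers => [j i|j]; first exact: induced_var0.
  have [i nz] := gnz j; exists i => z; apply: nz.
  by apply/funext => m; rewrite induced_varE; apply: (congr1 (fun F : pseries _ => F m) z).
(* d + 1 powers of u are one more than the codimension d allows to be
   independent; t^W is divisible by u on every branch. *)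
pose W := (\max_j w j)%N; pose M := (d.+1 * W)%N.
have [a pa rk] := rank_principal_open (family_monomial_mx phi M) p.
pose u j := (\sum_i family_var phi j i ^+ (B ^ i)) (w j).
exists ((\prod_j u j) * a), M.
have uE (q : Spec A) j : to_residue q (u j) =
    (\sum_(i < n) ps_map (to_residue q) (family_var phi j i) ^+ (B ^ i)) (w j).
  rewrite /u -[LHS]/(ps_map (to_residue q) _ _) rmorph_sum.
  by apply: (congr1 (fun F : pseries _ => F (w j))); apply: eq_bigr => i _; rewrite rmorphXn.
split=> [|q /principal_openM[/principal_open_prod uq aq]].
  apply/principal_openM; split => //; apply/principal_open_prod => j.
  by rewrite /principal_open -to_residue_eq0 uE.
have := conductor_of_rank (N := d.+1) (w := W) (@induced_cont A n r phi q)
  (sum_powers_const0 n _ B0).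
apply=> [j|].
  exists (w j); first exact: leq_bigmax.
  rewrite induced_sum_powers -[X in X != 0]/(to_residue q (u j)) to_residue_eq0.
  exact: uq.
have := rank_ge_of_basis_mod (@induced_cont A n r phi p) M bv.
rewrite !induced_monomial_mx -/M => le; rewrite addnS ltnS.
by apply: leq_trans le _; rewrite leq_add2r rk.
Qed.

Variables (M : nat) (q : Spec A).
Hypothesis cond : contains_conductor M q.

Lemma curve_normalization : is_normalization (@curve_incl A n r phi q).
Proof.
apply: (@normalization_of_conductor _ _ _ _ M) => [a|y vy|x y]; last exact: val_inj.
  by exists (curve_scalar phi a).
apply/curve_imageE/cond => j; exact: ps_vanish_le (vy j).
Qed.

Lemma curve_delta_rank : exists2 d, curve_delta phi q = Some d &
  (\rank (map_mx (to_residue q) (family_monomial_mx phi M)) + d)%N = (r * M)%N.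
Proof.
have imE : (fun y => exists x : curve_ring phi q, curve_incl x = y) =
    (fun y => exists f, induced phi (q := q) f = y).
  by apply/funext => y; apply/propext/curve_imageE.
have bE d := @basis_mod_normalization _ _ _ (@curve_incl A n r phi q)
  (curve_scalar phi (q := q)) d (fun=> erefl) curve_normalization.
rewrite imE in bE.
have [d [v0 bv0]] := basis_mod_exists (@induced_cont A n r phi q) cond.
have [d' [v [dE bv]]] : exists d v, curve_delta phi q = Some d /\ basis_mod
     (fun a (z : total_quotient (curve_ring phi q)) =>
        to_total_quotient (curve_scalar phi a) * z)
     (@integral_closure _) (fun z => exists x, to_total_quotient x = z) (v : 'I_d -> _).
  by apply: dim_mod_Some; exists d; apply/bE; exists v0.
exists d' => //; rewrite -induced_monomial_mx.
have [v' bv'] : exists v : 'I_d' -> _, basis_mod *:%R (fun=> True)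
    (fun y => exists f, induced phi (q := q) f = y) v by apply/bE; exists v.
exact: (basis_mod_size (@induced_cont A n r phi q) cond bv').
Qed.

End Semicontinuity.

Theorem theorem18 (A : comNzRingType) (n r : nat) (phi : param_family A n r)
    (p : Spec A) :
  noetherian A ->
  is_parameterization (induced phi (q := p)) ->
  branches_codim phi p <> None ->
  exists U : Spec A -> Prop,
    [/\ zariski_open U, U p,
        forall q : Spec A, U q -> is_normalization (@curve_incl A n r phi q) &
        upper_semicontinuous_on U (curve_delta phi)].
Proof.
move=> _ par fin; have [a [M [pa cond]]] := contains_conductor_near par fin.
exists (principal_open a); split=> //; first exact: zariski_open_principal.
  by move=> q /cond; apply: curve_normalization.
move=> p' ap'; have [b bp' rk] := rank_principal_open (family_monomial_mx phi M) p'.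
exists (principal_open (a * b)); split.
- exact: zariski_open_principal.
- exact/principal_openM.
- by move=> q /principal_openM[].
move=> q /principal_openM[/cond cq /rk le].
have [d -> dE] := curve_delta_rank cq; have [d' -> dE'] := curve_delta_rank (cond _ ap').
by move: le => /=; lia.
Qed.
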